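(* Consider Problem ESP: $\max_{X_T\in\mathcal X}\mathbb E[U((X_T-D_T)^+)]$ subject to $\mathbb E[(L-X_T)^+]\le\epsilon_{\mathbb P}$ and $\mathbb E[\xi X_T]\le x_0$. Its optimal terminal wealth is as follows. (i) If $L\le D_T$: $$X_T^{ESP}=\left((U')^{-1}(\lambda_1\xi)+D_T\right)\mathbf 1_{\xi<\xi_2}\quad\text{if }\xi_2\le\xi_1,$$ $$X_T^{ESP}=\left((U')^{-1}(\lambda_1\xi)+D_T\right)\mathbf 1_{\xi<\xi_1}+L\,\mathbf 1_{\xi_1\le\xi<\xi_2}\quad\text{if }\xi_1<\xi_2,$$ where $\xi_1=U'(\widetilde L-(D_T-L))/\lambda_1$, $\widetilde L$ is the tangent point of $U((X_T-D_T+L)^+)$, $\xi_2$ is defined through $\mathbb E[L\mathbf 1_{\xi\ge\xi_2}]=\epsilon_{\mathbb P}$, and $\lambda_1$ is obtained by solving $\mathbb E[\xi X_T^{ESP}]=x_0$. (ii) If $D_T<L\le\widehat D_T$: $$X_T^{ESP}=\left((U')^{-1}(\lambda_1\xi)+D_T\right)\mathbf 1_{\xi<\xi_2}\quad\text{if }\xi_2<\xi_1,$$ $$X_T^{ESP}=\left((U')^{-1}(\lambda_1\xi)+D_T\right)\mathbf 1_{\xi<\xi_1}+L\,\mathbf 1_{\xi_1\le\xi<\xi_2}\quad\text{if }\xi_1\le\xi_2,$$ where $\xi_1=U'(L-D_T)/\lambda_1$, $\xi_2$ is defined through $\mathbb E[L\mathbf 1_{\xi\ge\xi_2}]=\epsilon_{\mathbb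 P}$, and $\lambda_1$ is obtained by solving $\mathbb E[\xi X_T^{ESP}]=x_0$. (iii) If $L>\widehat D_T$: $$X_T^{ESP}=\left((U')^{-1}(\lambda_1\xi)+D_T\right)\mathbf 1_{\xi<\xi_1}+L\,\mathbf 1_{\xi_1\le\xi<\xi_2}+\left((U')^{-1}(\lambda_1\xi-\lambda_2)+D_T\right)\mathbf 1_{\xi_2\le\xi<\xi_3},$$ where $\xi_1=\frac{U'(L-D_T)}{\lambda_1}$, $\xi_2=\frac{U'(L-D_T)+\lambda_2}{\lambda_1}$, $\xi_3=\frac{U'(\widehat D_T-D_T)+\lambda_2}{\lambda_1}$, and $\lambda_1,\lambda_2$ are obtained by solving $\mathbb E[\xi X_T^{ESP}]=x_0$ and $\mathbb E[(L-X_T^{ESP})^+]=\epsilon_{\mathbb P}$.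
   Context: Market. Fix $T<\infty$ and a complete, frictionless continuous-time financial market with one risk-free asset $S_0$ and $m$ risky assets on a filtered probability space with physical measure $\mathbb P$ and unique local martingale measure $\mathbb Q$. $\mathbb E$ denotes expectation under $\mathbb P$. The state price density at time $T$ is $\xi=\frac{S_0(0)}{S_0(T)}\frac{d\mathbb Q}{d\mathbb P}$, assumed to be atomless. The initial capital is $x_0>0$, and $\mathcal X$ is the set of all $\mathcal F_T$-measurable, replicable, non-negative terminal wealths $X_T$ with $\mathbb E[\xi X_T]=x_0$. Utility and debt. $D_T>0$ is a constant (terminal debt level); $L>0$ and $\epsilon_{\mathbb P}>0$ are given constants. $U:[0,\infty)\to\mathbb R$ is strictly increasing, strictly concave, continuously differentiable on $(0,\infty)$, bounded from below with $U(0)=0$, and satisfies $\lim_{x\to0}U'(x)=\infty$, $\lim_{x\to\infty}U'(x)=0$, $\limsup_{x\to\infty}xU'(x)/U(x)<1$. $(U')^{-1}$ is the inverse function of $U'$. For $d>0$ the tangent point of $U((x-d)^+)$ is the unique $\hat d>d$ with $U(\hat d-d)/\hat d=U'(\hat d-d)$; $\widehat D_T$ is the tangent point for $d=D_T$, and for $L<D_T$, $\widetilde L$ is the tangent point for $d=D_T-L$. For $L=D_T$ one reads $\xi_1=+\infty$. Standing assumptions: an optimal solution of the problem exists, and the risk constraint is non-redundant, i.e. the optimal solution $X_T^B=[(U')^{-1}(\lambda_B\xi)+D_T]\mathbf 1_{\xi<\xi_B}$ of the problem without risk constraint (with $\xi_B=U'(\widehat D_T-D_T)/\lambda_B$ and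 $\lambda_B$ solving $\mathbb E[\xi X_T^B]=x_0$) violates the risk constraint. $\lambda_1,\lambda_2$ are the Lagrangian multipliers of the budget and the risk constraint. *)

(* Defs.v *)
From HB Require Import structures.
From mathcomp Require Export all_boot all_order all_algebra.
From mathcomp Require Export all_classical all_reals all_analysis.

Set Implicit Arguments.
Unset Strict Implicit.
Unset Printing Implicit Defensive.

Import Order.TTheory GRing.Theory Num.Theory.
Import numFieldNormedType.Exports.

Local Open Scope classical_set_scope.
Local Open Scope ring_scope.

Section processes.
Context {R : realType} {d : measure_display} {Omega : measurableType d}.
Implicit Types (F : R -> set_system Omega) (X : R -> Omega -> R).

Definition measurable_wrt (G : set_system Omega) (Y : Omega -> R) : Prop :=
  forall B : set R, measurable B -> G (Y @^-1` B).

(* The terminal sigma-algebra F T is the ambient one. *)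
Record filtration (T : R) F : Prop := Filtration {
  filtration_sigma : forall t : R, 0 <= t <= T -> sigma_algebra [set: Omega] (F t) ;
  filtration_mono : forall s t : R, 0 <= s -> s <= t -> t <= T -> F s `<=` F t ;
  filtration_end : F T = @measurable d Omega }.

Definition adapted (T : R) F X : Prop :=
  forall t : R, 0 <= t <= T -> measurable_wrt (F t) (X t).

Definition cadlag (T : R) X : Prop := forall w,
  (forall t : R, 0 <= t < T -> X s w @[s --> t^'+] --> X t w) /\
  (forall t : R, 0 < t <= T -> cvg (X s w @[s --> t^'-])).

Definition martingale (Q : probability Omega R) (T : R) F X : Prop :=
  [/\ adapted T F X,
      forall t : R, 0 <= t <= T -> Q.-integrable setT (EFin \o X t) &
      forall (s t : R) A, 0 <= s -> s <= t -> t <= T -> F s A ->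
        (\int[Q]_(w in A) (X t w)%:E = \int[Q]_(w in A) (X s w)%:E)%E].

Definition stopping_time (T : R) F (tau : Omega -> R) : Prop :=
  (forall w, 0 <= tau w <= T) /\
  (forall t : R, 0 <= t <= T -> F t [set w | tau w <= t]).

(* On the finite horizon [0, T] a localizing sequence is nondecreasing and
   almost surely eventually equal to T; the factor (0 < tau) avoids requiring
   X 0 to be integrable. *)
Definition local_martingale (Q : probability Omega R) (T : R) F X : Prop :=
  exists tau : nat -> Omega -> R,
    [/\ forall n, stopping_time T F (tau n),
        forall w, nondecreasing_seq (tau ^~ w),
        {ae Q, forall w, \forall n \near \oo, tau n w = T} &
        forall n, martingale Q T F (fun t w =>
          if 0 < tau n w then X (Num.min t (tau n w)) w else 0)].

End processes.

Section market.
Context {R : realType} {d : measure_display} {Omega : measurableType d}.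
Variables (P : probability Omega R) (m : nat).

Record market := Market {
  horizon : R ;
  info : R -> set_system Omega ;
  bond : R -> Omega -> R ;
  stock : 'I_m -> R -> Omega -> R ;
  pricing : probability Omega R ;
  replicable : set (Omega -> R) }.

Definition local_martingale_measure (M : market) (Q : probability Omega R) :=
  [/\ Q `<< P, P `<< Q &
      forall i, local_martingale Q (horizon M) (info M)
                  (fun t w => stock M i t w / bond M t w)].

Definition state_price (M : market) (w : Omega) : R :=
  bond M 0 w / bond M (horizon M) w *
  fine (Radon_Nikodym (charge_of_finite_measure (pricing M)) P w).

Definition price (M : market) (X : Omega -> R) : \bar R :=
  'E_P[fun w => (state_price M w * X w)%R]%E.

(* Trading itself is not modelled: [replicable] is an arbitrary set of terminal
   payoffs, of which only completeness is required, namely that it contains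
   every non-negative payoff of finite price. *)
Record complete_market (M : market) : Prop := CompleteMarket {
  horizon_gt0 : 0 < horizon M ;
  info_filtration : filtration (horizon M) (info M) ;
  bond_gt0 : forall (t : R) w, 0 <= t <= horizon M -> 0 < bond M t w ;
  bond_adapted : adapted (horizon M) (info M) (bond M) ;
  bond_cadlag : cadlag (horizon M) (bond M) ;
  stock_adapted : forall i, adapted (horizon M) (info M) (stock M i) ;
  stock_cadlag : forall i, cadlag (horizon M) (stock M i) ;
  pricing_lmm : local_martingale_measure M (pricing M) ;
  pricing_unique : forall Q, local_martingale_measure M Q ->
    forall A, measurable A -> Q A = pricing M A ;
  completeness : forall X : Omega -> R,
    measurable_wrt (info M (horizon M)) X -> (forall w, 0 <= X w) ->
    (price M X < +oo)%E -> replicable M X }.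

End market.

Section utility.
Context {R : realType}.
Variable U : R -> R.

(* U is only constrained on [0, +oo[; its values on the negative reals are
   irrelevant. *)
Record utility : Prop := Utility {
  utility_incr : forall x y : R, 0 <= x -> x < y -> U x < U y ;
  utility_concave : forall x y t : R, 0 <= x -> 0 <= y -> x != y -> 0 < t < 1 ->
    t * U x + (1 - t) * U y < U (t * x + (1 - t) * y) ;
  utility_derivable : forall x : R, 0 < x -> derivable U x 1 ;
  utility_C1 : forall x : R, 0 < x -> {for x, continuous (derive1 U)} ;
  utility_bounded_below : exists b : R, forall x : R, 0 <= x -> b <= U x ;
  utility0 : U 0 = 0 ;
  utility_inada0 : derive1 U x @[x --> 0^'+] --> +oo ;
  utility_inadaoo : derive1 U x @[x --> +oo] --> (0 : R) ;
  utility_elasticity :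
    (limf_esup (fun x : R => (x * derive1 U x / U x)%:E) (pinfty_nbhs R) < 1)%E }.

(* (U')^-1 on ]0, +oo[, with value 0 at the points outside the range of U'. *)
Definition inv_marginal (y : R) : R :=
  xget 0 [set x | 0 < x /\ derive1 U x = y].

Definition tangent_point (a : R) : R :=
  xget 0 [set x | a < x /\ U (x - a) / x = derive1 U (x - a)].

End utility.

Section problem.
Context {R : realType} {d : measure_display} {Omega : measurableType d}.
Variables (P : probability Omega R) (m : nat).
Variables (M : market (Omega := Omega) (R := R) m).
Variables (U : R -> R) (x0 D L eps : R).
Implicit Types (X Y : Omega -> R).

Let xi : Omega -> R := state_price P M.

Definition expected_utility X : \bar R :=
  'E_P[fun w => U (Num.max (X w - D) 0)%R]%E.

Definition shortfall X : \bar R := 'E_P[fun w => Num.max (L - X w)%R 0%R]%E.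

Definition nonneg_claim X : Prop :=
  measurable_wrt (info M (horizon M)) X /\ forall w, 0 <= X w.

Definition wealths : set (Omega -> R) :=
  [set X | [/\ nonneg_claim X, replicable M X & price P M X = x0%:E]].

Definition feasible X : Prop :=
  [/\ wealths X, (shortfall X <= eps%:E)%E & (price P M X <= x0%:E)%E].

Definition optimal X : Prop :=
  feasible X /\
  forall Y, feasible Y -> (expected_utility Y <= expected_utility X)%E.

Definition the_optimal X : Prop :=
  optimal X /\ forall Y, optimal Y -> {ae P, forall w, Y w = X w}.

Definition lagrangian (l1 l2 : R) X : \bar R :=
  (expected_utility X - l1%:E * (price P M X - x0%:E)
     - l2%:E * (shortfall X - eps%:E))%E.

(* (X, l1, l2) is a saddle point: X maximizes the Lagrangian over all
   non-negative claims of finite price, with complementary slackness. *)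
Record lagrange_multipliers X (l1 l2 : R) : Prop := LagrangeMultipliers {
  multiplier_budget_ge0 : 0 <= l1 ;
  multiplier_risk_ge0 : 0 <= l2 ;
  multiplier_max : forall Y, nonneg_claim Y -> (price P M Y < +oo)%E ->
    (lagrangian l1 l2 Y <= lagrangian l1 l2 X)%E ;
  multiplier_budget_slack : (l1%:E * (price P M X - x0%:E) = 0)%E ;
  multiplier_risk_slack : (l2%:E * (shortfall X - eps%:E) = 0)%E }.

Definition X_B (lB : R) (w : Omega) : R :=
  (inv_marginal U (lB * xi w) + D)
    * (xi w < derive1 U (tangent_point U D - D) / lB)%R%:R.

Definition non_redundant : Prop := exists lB : R,
  [/\ 0 < lB, price P M (X_B lB) = x0%:E & (eps%:E < shortfall (X_B lB))%E].

Definition threshold_eq (xi2 : R) : Prop :=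
  ('E_P[fun w => (L * (xi2 <= xi w)%R%:R)%R] = eps%:E)%E.

Definition ESP_low_xi1 (l1 : R) : \bar R :=
  if L < D
  then (derive1 U (tangent_point U (D - L) - (D - L)) / l1)%:E
  else +oo%E.

Definition X_ESP_low (l1 xi2 : R) (w : Omega) : R :=
  let xi1 := ESP_low_xi1 l1 in
  if (xi2%:E <= xi1)%E
  then (inv_marginal U (l1 * xi w) + D) * (xi w < xi2)%R%:R
  else (inv_marginal U (l1 * xi w) + D) * ((xi w)%:E < xi1)%E%:R
       + L * ((xi1 <= (xi w)%:E)%E && (xi w < xi2)%R)%:R.

Definition X_ESP_mid (l1 xi2 : R) (w : Omega) : R :=
  let xi1 := derive1 U (L - D) / l1 in
  if xi2 < xi1
  then (inv_marginal U (l1 * xi w) + D) * (xi w < xi2)%R%:R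
  else (inv_marginal U (l1 * xi w) + D) * (xi w < xi1)%R%:R
       + L * (xi1 <= xi w < xi2)%R%:R.

Definition X_ESP_high (l1 l2 : R) (w : Omega) : R :=
  let xi1 := derive1 U (L - D) / l1 in
  let xi2 := (derive1 U (L - D) + l2) / l1 in
  let xi3 := (derive1 U (tangent_point U D - D) + l2) / l1 in
  (inv_marginal U (l1 * xi w) + D) * (xi w < xi1)%R%:R
  + L * (xi1 <= xi w < xi2)%R%:R
  + (inv_marginal U (l1 * xi w - l2) + D) * (xi2 <= xi w < xi3)%R%:R.

End problem.

(* Main.v *)
Require Import Defs.
From HB Require Import structures.
From mathcomp Require Import all_boot all_order all_algebra.
From mathcomp Require Import all_classical all_reals all_analysis.
From mathcomp Require Import measurable_realfun ring lra.
Import Order.TTheory GRing.Theory Num.Theory.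
Import numFieldNormedType.Exports.
Local Open Scope classical_set_scope.
Local Open Scope ring_scope.

(** For multipliers [l1], [l2] and a state price [z] consider the scalar
    function
      f (y) = U ((y - D)^+) - l1 z y - l2 (L - y)^+.
    Up to a constant the Lagrangian of a claim [X] is the expectation of
    f (X w) at z = xi w, and claims may be modified freely on bounded events, so
    a claim maximizes the Lagrangian only if X w maximizes f at almost every
    [w] ([pointwise_max]).  The candidates of the theorem are the maximizers of
    f; they are unique for all but finitely many [z], and these exceptional
    values have probability zero because the state price is atomless.

    The multipliers of the given optimum are however not known explicitly, and
    an optimal claim has to be compared with candidates built on other
    multipliers.  This is the role of [saddle_unique]: if X0 maximizes f
    pointwise for (k1, k2), if X is the strict pointwise maximizer for
    (l1, l2), and if X and X0 have the same price (or k1 = l1) and the same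
    expected shortfall (or k2 = l2), then X = X0 almost surely.  Indeed the
    utility difference is squeezed between two combinations of the price
    and shortfall differences, and the gap between the two has expectation zero.
    It is used three times.
    - Applied to the unconstrained optimum X_B, it shows that a vanishing
      risk multiplier would make X_B feasible, against non-redundancy.  So every
      optimal claim has expected shortfall exactly [eps].
    - Applied to the candidate built on the multipliers of the given optimum,
      it identifies the candidate with that optimum, so the candidate solves
      the budget and risk equations.
    - Applied to an arbitrary optimal claim and to a candidate for any
      multipliers that solve these equations, it gives optimality and almost
      sure uniqueness.

    It remains to recognize the candidates as pointwise maximizers.  The call
    payoff U ((y - D)^+) is not concave; a linear cost [p y] is best met
    at [inv_marginal U p + D] or at 0, according to the side of the slope of the
    tangent drawn from the origin on which [p] lies
    ([call_strict_argmax_active], [call_strict_argmax_default]).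
    In cases (i) and (ii) the payoff lies below its chord on [0, L], so
    the maximizer of f is either 0 or the maximizer over y >= L, on which [l2]
    has no influence.  One can then choose [l2] to make the two tie exactly
    at the prescribed threshold ([threshold_strict_argmax]); this [l2] may be
    negative, which is harmless since the comparison involves claims of equal
    expected shortfall.  In case (iii) the maximizer lies above, at or
    below [L] according to the slopes of f on the two sides of the kink. *)

(** * Utility functions *)

Section utility_theory.
Context {R : realType} {U : R -> R} (hU : utility U).

Local Notation dU := (derive1 U).

Lemma utility_le x y : 0 <= x -> x <= y -> U x <= U y.
Proof.
move=> x0; rewrite le_eqVlt => /predU1P[->//|xy].
exact/ltW/(utility_incr hU).
Qed.

Lemma utility_ge0 x : 0 <= x -> 0 <= U x.
Proof. by move=> x0; rewrite -(utility0 hU) utility_le. Qed.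

(** A reparametrized form of strict concavity: the point [y] strictly between
    [a] and [x] is the data, not the weight. *)
Lemma lt_secant a x y : 0 <= a -> 0 <= x -> x != a ->
   0 < (y - a) / (x - a) < 1 -> (y - a) / (x - a) * (U x - U a) < U y - U a.
Proof.
move=> a0 x0 xa t01.
have := utility_concave hU x0 a0 xa t01.
set t := (y - a) / (x - a) in t01 *.
have -> : t * x + (1 - t) * a = y.
  by rewrite /t; field; rewrite subr_eq0.
lra.
Qed.

(** The difference quotient at [a] dominates the slope of the secant through
    [x], on the side of [a] where [x] lies; the derivative is the one-sided
    limit of these quotients. *)
Lemma le_tangent a x : 0 < a -> 0 <= x -> U x <= U a + dU a * (x - a).
Proof.
move=> a0 x0.
have [->|xa] := eqVneq x a; first by rewrite subrr mulr0 addr0.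
have cvU : h^-1 *: ((U \o shift a) (h *: 1) - U a) @[h --> 0^'] --> dU a.
  by rewrite derive1E; exact: (utility_derivable hU).
rewrite -lerBlDl.
have slope (h : R) : h != 0 -> 0 < h / (x - a) < 1 ->
    h / (x - a) * (U x - U a) <= (U \o shift a) (h *: (1 : R)) - U a.
  move=> h0 hx /=; apply/ltW.
  have -> : h / (x - a) = ((h + a) - a) / (x - a) by rewrite addrK.
  rewrite /GRing.scale/= mulr1; apply: lt_secant => //; first exact: ltW.
  by rewrite addrK.
move: xa; rewrite neq_lt => /orP[xlt|xgt].
- suff : dU a <= (U x - U a) / (x - a).
    by rewrite ler_ndivlMr// subr_lt0.
  have cvl : h^-1 *: ((U \o shift a) (h *: 1) - U a) @[h --> 0^'-] --> dU a.
    apply: cvg_trans cvU; apply: cvg_app => A /nbhs_ballP [e e0 eA].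
    by exists e => //= y ey /lt_eqF/negbT/eA; exact.
  apply: (cvgr_to_le cvl).
  near=> h.
  have h0 : h < 0 by near: h; exact: nbhs_left_lt.
  have xh : x - a < h by near: h; apply: nbhs_left_gt; rewrite subr_lt0.
  have := slope h (negbT (lt_eqF h0)).
  have -> : 0 < h / (x - a) < 1.
    rewrite ltr_ndivrMr ?subr_lt0// mul1r xh andbT.
    by rewrite ltr_ndivlMr ?subr_lt0// mul0r.
  move=> /(_ isT) H.
  rewrite /GRing.scale/= in H *.
  rewrite mulrC ler_ndivrMr//; apply: le_trans H.
  by rewrite le_eqVlt; apply/orP; left; apply/eqP; ring.
- suff : (U x - U a) / (x - a) <= dU a.
    by rewrite ler_pdivrMr// subr_gt0.
  have cvr : h^-1 *: ((U \o shift a) (h *: 1) - U a) @[h --> 0^'+] --> dU a.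
    apply: cvg_trans cvU; apply: cvg_app => A /nbhs_ballP [e e0 eA].
    by exists e => //= y ey /gt_eqF/negbT/eA; exact.
  apply: (cvgr_to_ge cvr).
  near=> h.
  have h0 : 0 < h by near: h; exact: nbhs_right_gt.
  have xh : h < x - a by near: h; apply: nbhs_right_lt; rewrite subr_gt0.
  have := slope h (negbT (gt_eqF h0)).
  have -> : 0 < h / (x - a) < 1.
    rewrite ltr_pdivrMr ?subr_gt0// mul1r xh andbT.
    by rewrite ltr_pdivlMr ?subr_gt0// mul0r.
  move=> /(_ isT) H.
  rewrite /GRing.scale/= in H *.
  rewrite [leRHS]mulrC ler_pdivlMr//; apply: le_trans H.
  by rewrite le_eqVlt; apply/orP; left; apply/eqP; ring.
Unshelve. all: by end_near. Qed.

(** Strictness is recovered from [le_tangent] at the midpoint of [a] and [x],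
    where concavity is strict. *)
Lemma lt_tangent a x : 0 < a -> 0 <= x -> x != a ->
  U x < U a + dU a * (x - a).
Proof.
move=> a0 x0 xa.
have h01 : 0 < (2^-1 : R) < 1 by apply/andP; split; lra.
have := utility_concave hU x0 (ltW a0) xa h01.
have m0 : 0 <= 2^-1 * x + (1 - 2^-1) * a by lra.
have := le_tangent _ _ a0 m0.
lra.
Qed.

Lemma marginal_gt0 a : 0 < a -> 0 < dU a.
Proof.
move=> a0.
have a10 : 0 <= a + 1 by lra.
have a1 : a + 1 != a by rewrite -subr_eq0 addrAC subrr add0r oner_eq0.
have := lt_tangent _ _ a0 a10 a1.
have : U a < U (a + 1) by apply: (utility_incr hU); lra.
lra.
Qed.

Lemma marginal_lt a b : 0 < a -> a < b -> dU b < dU a.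
Proof.
move=> a0 ab; have b0 : 0 < b by lra.
have := lt_tangent _ _ a0 (ltW b0).
have := lt_tangent _ _ b0 (ltW a0).
rewrite lt_eqF// gt_eqF// => /(_ isT) h1 /(_ isT) h2.
nra.
Qed.

Lemma marginal_le a b : 0 < a -> a <= b -> dU b <= dU a.
Proof.
by move=> a0; rewrite le_eqVlt => /predU1P[->//|/marginal_lt] => /(_ a0)/ltW.
Qed.

Lemma exists_large_marginal (p : R) : exists2 x, 0 < x & p < dU x.
Proof.
have /cvgryPgt/(_ p) := utility_inada0 hU.
rewrite near_withinE => H.
near (0 : R)^'+ => x; exists x; near: x.
  exact: nbhs_right_gt.
exact: H.
Unshelve. all: by end_near. Qed.

Lemma exists_small_marginal (p : R) : 0 < p ->
  exists M, forall x, M < x -> dU x < p.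
Proof.
move=> p0.
have /cvgr_lt/(_ p p0) := utility_inadaoo hU.
by move=> [M [_ H]]; exists M.
Qed.

(** Intermediate values of the continuous marginal utility between its two
    Inada limits. *)
Lemma marginal_surj p : 0 < p -> exists x, 0 < x /\ dU x = p.
Proof.
move=> p0.
have [a a0 pa] := exists_large_marginal p.
have [M HM] := exists_small_marginal _ p0.
pose b := Num.max (a + 1) (M + 1).
have ab : a <= b by rewrite le_max; apply/orP; left; lra.
have pb : dU b < p by apply: HM; rewrite lt_max; apply/orP; right; lra.
have [||x] := @IVT R dU a b p ab.
- apply: continuous_in_subspaceT => x; rewrite inE/= in_itv/= => /andP[ax _].
  by apply: (utility_C1 hU); lra.
- by rewrite ge_min le_max (ltW pa) (ltW pb) orbT.
- rewrite in_itv/= => /andP[ax _] <-; exists x; split => //; lra.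
Qed.

Lemma inv_marginalP p : 0 < p ->
  0 < inv_marginal U p /\ dU (inv_marginal U p) = p.
Proof.
move=> p0; rewrite /inv_marginal; case: xgetP => [y -> //|H].
by have [x Hx] := marginal_surj _ p0; case: (H x).
Qed.

Lemma inv_marginal_gt0 p : 0 < p -> 0 < inv_marginal U p.
Proof. by move=> /inv_marginalP[]. Qed.

Lemma inv_marginalK p : 0 < p -> dU (inv_marginal U p) = p.
Proof. by move=> /inv_marginalP[]. Qed.

Lemma marginalK x : 0 < x -> inv_marginal U (dU x) = x.
Proof.
move=> x0; have [y0 yx] := inv_marginalP _ (marginal_gt0 _ x0).
set y := inv_marginal U (dU x) in y0 yx *.
have [xy|xy|//] := ltgtP y x.
- by have := marginal_lt _ _ y0 xy; rewrite yx ltxx.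
- by have := marginal_lt _ _ x0 xy; rewrite yx ltxx.
Qed.

Lemma inv_marginal_le0 p : p <= 0 -> inv_marginal U p = 0.
Proof.
move=> p0; rewrite /inv_marginal; case: xgetP => [y _ [y0 yp]|//].
by have := marginal_gt0 _ y0; rewrite yp ltNge p0.
Qed.

Lemma inv_marginal_ge0 p : 0 <= inv_marginal U p.
Proof.
by have [/inv_marginal_le0->//|/inv_marginal_gt0/ltW] := leP p 0.
Qed.

Lemma lt_inv_marginal p x : 0 < p -> 0 < x ->
  (x < inv_marginal U p) = (p < dU x).
Proof.
move=> p0 x0; have [y0 yp] := inv_marginalP _ p0.
apply/idP/idP => [xy|]; first by rewrite -yp marginal_lt.
by apply: contraTT; rewrite -!leNgt => xy; rewrite -yp marginal_le.
Qed.

(** [inv_marginal U p] is the maximizer in the convex conjugate of [U]: this is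
    [lt_tangent] at the point of slope [p]. *)
Lemma lt_conjugate p x : 0 < p -> 0 <= x -> x != inv_marginal U p ->
  U x - p * x < U (inv_marginal U p) - p * inv_marginal U p.
Proof.
move=> p0 x0 xp; have [y0 yp] := inv_marginalP _ p0.
by have := lt_tangent _ _ y0 x0 xp; rewrite yp; lra.
Qed.

Lemma le_conjugate p x : 0 < p -> 0 <= x ->
  U x - p * x <= U (inv_marginal U p) - p * inv_marginal U p.
Proof.
move=> p0 x0; have [->//|xp] := eqVneq x (inv_marginal U p).
exact/ltW/lt_conjugate.
Qed.

(** The function U x - U' x * (x + a) changes sign: near 0 the term a U' x
    dominates since U' is unbounded, while for large [x] the tangent line at [x]
    lies above U 1 at 1, so that U x - x U' x >= U 1 - U' x with U' x
    tending to 0. *)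
Lemma tangent_pointP a : 0 < a ->
  a < tangent_point U a /\
  U (tangent_point U a - a) / tangent_point U a = dU (tangent_point U a - a).
Proof.
move=> a0; rewrite /tangent_point; case: xgetP => [y -> //|H].
suff [x [x0 xE]] : exists x, 0 < x /\ U x = dU x * (x + a).
  case: (H (x + a)); split; first by rewrite ltrDr.
  by rewrite addrK xE mulfK// gt_eqF// addr_gt0.
pose g x := U x - dU x * (x + a).
(* [g b <= 0] once a U' b exceeds U 1 and b <= 1. *)
have [b b0 gb] : exists2 b, 0 < b <= 1 & g b <= 0.
  have [b b0 Hb] := exists_large_marginal (Num.max (U 1 / a) (dU 1)).
  move: Hb; rewrite gt_max => /andP[Hb b1].
  have {}b1 : b < 1.
    by apply: contraTT b1; rewrite -!leNgt => /marginal_le; exact.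
  exists b; first by rewrite b0 ltW.
  rewrite ltr_pdivrMr// in Hb.
  have := marginal_gt0 _ b0.
  have := utility_le _ _ (ltW b0) (ltW b1).
  rewrite /g; nra.
have /andP[b1 b2] := b0.
have U1 : 0 < U 1 by rewrite -(utility0 hU) (utility_incr hU).
(* Beyond [M], U' x (a + 1) < U 1, which makes g x positive by the tangent at x
   evaluated at 1. *)
have q0 : 0 < U 1 / (a + 1) by apply: divr_gt0 => //; lra.
have [M HM] := exists_small_marginal _ q0.
pose c := Num.max 2 (M + 1).
have c2 : 2 <= c by rewrite le_max lexx.
have gc : 0 <= g c.
  have : dU c < U 1 / (a + 1).
    by apply: HM; rewrite lt_max; apply/orP; right; lra.
  rewrite ltr_pdivlMr; last lra.
  have c0 : 0 < c by lra.
  have := le_tangent _ _ c0 ler01.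
  rewrite /g; lra.
have bc : b <= c by lra.
have [||x] := @IVT R g b c 0 bc.
- apply: continuous_in_subspaceT => x; rewrite inE/= in_itv/= => /andP[bx _].
  have x0 : 0 < x by lra.
  apply: cvgB.
    apply/differentiable_continuous/derivable1_diffP.
    exact: (utility_derivable hU).
  apply: cvgM; first exact: (utility_C1 hU).
  by apply: cvgD; [exact: cvg_id|exact: cvg_cst].
- by rewrite ge_min le_max gb gc orbT.
- rewrite in_itv/= => /andP[bx _] /eqP; rewrite subr_eq0 => /eqP gx.
  by exists x; split => //; lra.
Qed.

End utility_theory.

(** * Strict maximizers and the threshold rule *)

Definition strict_argmax {R : realType} (b : R) (g : R -> R) (x : R) : Prop :=
  b <= x /\ forall y, b <= y -> y != x -> g y < g x.

Lemma strict_argmax_le {R : realType} {b : R} {g : R -> R} {x : R} :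
  strict_argmax b g x -> forall y, b <= y -> g y <= g x.
Proof.
by move=> [_ H] y y0; have [->//|yx] := eqVneq y x; exact/ltW/H.
Qed.

Section threshold_rule.
Context {R : realType} {u : R -> R} {L : R} (L0 : 0 < L) (u0 : u 0 = 0)
  (star : forall y, 0 <= y -> y <= L -> u y * L <= u L * y)
  (attained : forall p, 0 < p ->
    exists2 x, L <= x & forall y, L <= y -> u y - p * y <= u x - p * x).

(** Below [L] the payoff [u] lies under its chord, so at cost slope [l1 t] no
    [y] in [0, L] beats both ends of that interval. Choosing [l2] so that 0 and
    the best [y >= L] tie at the state price [t] settles all other state prices,
    because passing from [t] to [z] tilts the objective by [l1 (t - z) y], which
    favours large [y] for [z < t] and 0 for [z > t]. *)
Lemma threshold_strict_argmax l1 t : 0 < l1 -> 0 < t ->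
  exists l2, forall z x, 0 < z -> z != t ->
    (z < t -> strict_argmax L (fun y => u y - l1 * z * y) x) ->
    (t < z -> x = 0) ->
    strict_argmax 0 (fun y => u y - l1 * z * y - l2 * Num.max (L - y) 0) x.
Proof.
move=> l10 t0.
have p20 : 0 < l1 * t by rewrite mulr_gt0.
have [x2 Lx2 maxx2] := attained _ p20.
pose l2 := (l1 * t * x2 - u x2) / L.
have l2E : l2 * L = l1 * t * x2 - u x2 by rewrite /l2 divfK// gt_eqF.
exists l2 => z x z0 zt xlt xgt.
(* [- (l2 * L)] is the common value at 0 and at [x2]. *)
have tie y : 0 <= y ->
    u y - l1 * t * y - l2 * Num.max (L - y) 0 <= - (l2 * L).
  move=> y0; have [yL|Ly] := leP y L.
    rewrite max_l ?subr_ge0//.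
    have h1 := star _ y0 yL.
    have h2 := maxx2 _ (lexx L).
    have h3 : (u L - l1 * t * L + l2 * L) * y <= 0.
      by apply: mulr_le0_ge0 => //; lra.
    have : (u y - l1 * t * y + l2 * y) * L <= 0 by lra.
    by rewrite pmulr_lle0//; lra.
  rewrite max_r; last by rewrite subr_le0 ltW.
  have := maxx2 _ (ltW Ly); lra.
have [{xgt}|{xlt}tz|ztE] := ltgtP z t; last by rewrite ztE eqxx in zt.
- move=> ztl; have {xlt}[Lx xmax] := xlt ztl.
  have l1tz : 0 < l1 * t - l1 * z by rewrite -mulrBr mulr_gt0// subr_gt0.
  split=> [|y y0 yx]; first by apply: le_trans Lx; exact: ltW.
  rewrite [in ltRHS]max_r ?subr_le0// mulr0 subr0.
  have [Ly|yL] := leP L y.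
    by rewrite max_r ?subr_le0// mulr0 subr0 xmax.
  apply: (@le_lt_trans _ _ (- (l2 * L) + (l1 * t - l1 * z) * y)).
    have := tie _ y0; lra.
  apply: (@lt_le_trans _ _ (- (l2 * L) + (l1 * t - l1 * z) * x2)).
    by rewrite ltrD2l ltr_pM2l//; lra.
  have /= := strict_argmax_le (conj Lx xmax) _ Lx2; lra.
- rewrite (xgt tz); split=> // y y0 yn0.
  have {}y0 : 0 < y by rewrite lt_neqAle eq_sym yn0.
  rewrite u0 mulr0 !subr0 [Num.max L 0]max_l ?sub0r; last exact: ltW.
  have := tie _ (ltW y0).
  have : 0 < (l1 * z - l1 * t) * y.
    by rewrite -mulrBr !mulr_gt0// subr_gt0.
  lra.
Qed.

End threshold_rule.

(** * The payoff of a call option on the terminal wealth *)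

Section call_payoff.
Context {R : realType} {U : R -> R} (hU : utility U).

Local Notation dU := (derive1 U).
Local Notation I := (inv_marginal U).
Local Notation call a y := (U (Num.max (y - a) 0)).

Lemma call_low a y : y <= a -> call a y = 0.
Proof. by move=> ya; rewrite max_r ?subr_le0// (utility0 hU). Qed.

Lemma call_high a y : a <= y -> call a y = U (y - a).
Proof. by move=> ya; rewrite max_l ?subr_ge0. Qed.

(** Above the strike the problem is that of the conjugate of [U], shifted. *)
Lemma call_strict_argmax_strike a p : 0 < p ->
  strict_argmax a (fun y => call a y - p * y) (I p + a).
Proof.
move=> p0; have I0 := inv_marginal_gt0 hU _ p0.
split=> [|y ay yI]; first by rewrite lerDr ltW.
rewrite !call_high// ?addrK; last by rewrite lerDr ltW.
have ya0 : 0 <= y - a by rewrite subr_ge0.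
have := lt_conjugate hU _ _ p0 ya0.
rewrite subr_eq yI => /(_ isT); lra.
Qed.

Lemma call_strict_argmax_inside a L p : a < L -> 0 < p -> p <= dU (L - a) ->
  strict_argmax L (fun y => call a y - p * y) (I p + a).
Proof.
move=> aL p0 pL; have [_ H] := call_strict_argmax_strike a _ p0.
split=> [|y Ly]; last by apply: H; lra.
move: pL; have La0 : 0 < L - a by lra.
by apply: contraTT; rewrite -!ltNge => h; rewrite -(inv_marginalK hU _ p0);
  apply: marginal_lt => //; [exact: inv_marginal_gt0|lra].
Qed.

(** When the cost slope is at least the marginal utility at [L], concavity makes
    the objective decrease on the whole of y >= L. *)
Lemma call_strict_argmax_boundary a L p : a < L -> dU (L - a) <= p ->
  strict_argmax L (fun y => call a y - p * y) L.
Proof.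
move=> aL pL; have La0 : 0 < L - a by lra.
split=> // y Ly yL; rewrite !call_high//; [|lra|lra].
have ya0 : 0 <= y - a by lra.
have := lt_tangent hU _ _ La0 ya0.
rewrite (inj_eq (addIr _)) yL => /(_ isT).
have : (dU (L - a) - p) * (y - L) <= 0 by apply: mulr_le0_ge0; lra.
lra.
Qed.

(** The equation that defines the tangent point says that the tangent to the
    payoff there passes through the origin. *)
Lemma tangent_line a x : 0 < a -> 0 <= x ->
  U x <= dU (tangent_point U a - a) * (x + a).
Proof.
move=> a0 x0; have [ta] := tangent_pointP hU _ a0.
set t := tangent_point U a in ta *.
have t0 : 0 < t by lra.
move/(congr1 ( *%R^~ t)); rewrite divfK ?gt_eqF// => tE.
have ta0 : 0 < t - a by lra.
by have := le_tangent hU _ _ ta0 x0; rewrite tE; lra.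
Qed.

(** A cost slope flatter than the tangent from the origin leaves a positive gain
    already at the tangent point, hence at the maximizer above the strike,
    whereas the objective is not positive below the strike. *)
Lemma call_strict_argmax_active a p : 0 < a -> 0 < p ->
  p < dU (tangent_point U a - a) ->
  strict_argmax 0 (fun y => call a y - p * y) (I p + a).
Proof.
move=> a0 p0 pt; have [ta] := tangent_pointP hU _ a0.
set t := tangent_point U a in ta pt *.
have t0 : 0 < t by lra.
move/(congr1 ( *%R^~ t)); rewrite divfK ?gt_eqF// => tE.
have I0 := inv_marginal_gt0 hU _ p0.
split=> [|y y0 yI]; first lra.
have [ay|ya] := leP a y; first by apply: (call_strict_argmax_strike a _ p0).2.
rewrite call_low ?(ltW ya)// call_high; last lra.
rewrite addrK.
have ta0 : 0 <= t - a by lra.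
have := le_conjugate hU _ _ p0 ta0.
have : 0 < (dU (t - a) - p) * t by rewrite mulr_gt0// subr_gt0.
have : 0 <= p * y by rewrite mulr_ge0// ltW.
lra.
Qed.

(** A linear cost steeper than the tangent from the origin exceeds the payoff
    everywhere. At equality 0 is still optimal but no longer the only maximizer,
    so the weak and the strict form are both stated. *)
Lemma call_argmax_default a p y : 0 < a -> dU (tangent_point U a - a) <= p ->
  0 <= y -> call a y <= p * y.
Proof.
move=> a0 tp y0.
have p0 : 0 < dU (tangent_point U a - a).
  by apply: marginal_gt0 => //; have [] := tangent_pointP hU _ a0; lra.
have [ay|ya] := leP a y; last first.
  by rewrite call_low ?(ltW ya)// mulr_ge0// (le_trans (ltW p0)).
have ya0 : 0 <= y - a by lra.
rewrite call_high//; have := tangent_line _ _ a0 ya0.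
rewrite subrK => /le_trans; apply; exact: ler_wpM2r.
Qed.

Lemma call_strict_argmax_default a p : 0 < a ->
  dU (tangent_point U a - a) < p ->
  strict_argmax 0 (fun y => call a y - p * y) 0.
Proof.
move=> a0 tp; split=> // y y0 yn0.
have {}y0 : 0 < y by rewrite lt_neqAle eq_sym yn0.
have := call_argmax_default _ _ _ a0 (lexx _) (ltW y0).
have : dU (tangent_point U a - a) * y < p * y by rewrite ltr_pM2r.
rewrite [call a 0]call_low ?(ltW a0)// mulr0; lra.
Qed.

(** Left of the tangent point the average payoff is nondecreasing: the
    tangent at [L] is at least as steep as the line from the origin. *)
Lemma call_star a L : 0 < a -> L <= tangent_point U a ->
  forall y, 0 <= y -> y <= L -> call a y * L <= call a L * y.
Proof.
move=> a0 Lt y y0 yL; have [ya|ay] := leP y a.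
  by rewrite call_low// mul0r mulr_ge0// utility_ge0// le_max lexx orbT.
rewrite !call_high; [|lra|lra].
have La0 : 0 < L - a by lra.
have ya0 : 0 <= y - a by lra.
have := le_tangent hU _ _ La0 ya0.
have := tangent_line _ _ a0 (ltW La0).
have : dU (tangent_point U a - a) <= dU (L - a).
  by apply: marginal_le => //; lra.
set q := dU (L - a); set p := dU _; rewrite subrK => pq Up Uq.
have L0 : 0 < L by lra.
have : 0 <= (q * L - U (L - a)) * (L - y).
  apply: mulr_ge0; last lra.
  by rewrite subr_ge0 (le_trans Up)// ler_pM2r.
have : U (y - a) * L <= (U (L - a) + q * (y - a - (L - a))) * L.
  by rewrite ler_pM2r.
lra.
Qed.

End call_payoff.

(** * Pointwise maximizers in the three regimes *)

Section regimes.
Context {R : realType} {d : measure_display} {Omega : measurableType d}.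
Context {P : probability Omega R} {m : nat}.
Context {M : market (R := R) (Omega := Omega) m}.
Context {U : R -> R} {D L : R} (hU : utility U) (D0 : 0 < D) (L0 : 0 < L).

Local Notation dU := (derive1 U).
Local Notation I := (inv_marginal U).
Local Notation xi := (state_price P M).
Local Notation u y := (U (Num.max (y - D) 0)).

(** For [L <= D], restricting to y >= L is moving the origin to [L], which turns
    the strike [D] into [D - L]; this is why the tangent point for [D - L]
    appears. *)
Lemma call_shift p x :
  strict_argmax 0 (fun y => U (Num.max (y - (D - L)) 0) - p * y) x ->
  strict_argmax L (fun y => u y - p * y) (x + L).
Proof.
move=> [x0 H]; split=> [|y Ly yx]; first by rewrite lerDr.
have y0 : 0 <= y - L by lra.
have := H _ y0; rewrite subr_eq => /(_ yx).
have -> : y - L - (D - L) = y - D by lra.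
have -> : x + L - D = x - (D - L) by lra.
lra.
Qed.

Section low.
Hypothesis LD : L <= D.

Lemma low_star y : 0 <= y -> y <= L -> u y * L <= u L * y.
Proof.
move=> y0 yL; rewrite call_low//; last exact: le_trans LD.
by rewrite mul0r mulr_ge0// utility_ge0// le_max lexx orbT.
Qed.

Lemma low_attained p : 0 < p ->
  exists2 x, L <= x & forall y, L <= y -> u y - p * y <= u x - p * x.
Proof.
move=> p0; move: LD; rewrite le_eqVlt => /predU1P[LDE|ltLD].
  exists (I p + D); have := call_strict_argmax_strike hU D _ p0; rewrite LDE.
    by case.
  exact: strict_argmax_le.
have a0 : 0 < D - L by lra.
have [pt|tp] := ltP p (dU (tangent_point U (D - L) - (D - L))).
  have H := call_shift _ _ (call_strict_argmax_active hU _ _ a0 p0 pt).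
  by exists (I p + (D - L) + L); [case: H|exact: (strict_argmax_le H)].
exists L => // y Ly.
have y0 : 0 <= y - L by lra.
have := call_argmax_default hU _ _ _ a0 tp y0.
rewrite [u L]call_low//.
have -> : y - L - (D - L) = y - D by lra.
lra.
Qed.

(** The branch [xi2 <= xi1] of the definition agrees with the other one, since a
    state price below [xi2] is then below [xi1]. *)
Lemma X_low_argmax l1 xi2 w : 0 < l1 -> 0 < xi w ->
  (xi w)%:E != ESP_low_xi1 U D L l1 -> xi w < xi2 ->
  strict_argmax L (fun y => u y - l1 * xi w * y) (X_ESP_low P M U D L l1 xi2 w).
Proof.
move=> l10 z0; rewrite /X_ESP_low /ESP_low_xi1.
set z := xi w in z0 *; have p0 : 0 < l1 * z by rewrite mulr_gt0.
move: LD; rewrite le_eqVlt => /predU1P[LDE|ltLD].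
  rewrite LDE ltxx leey => _ ->; rewrite mulr1.
  exact: call_strict_argmax_strike.
rewrite ltLD; have a0 : 0 < D - L by lra.
set t := dU _; rewrite eqe !lee_fin lte_fin => zt z2.
have active : z < t / l1 ->
    strict_argmax L (fun y => u y - l1 * z * y) (I (l1 * z) + D).
  rewrite ltr_pdivlMr// mulrC.
  move=> /(call_strict_argmax_active hU _ _ a0 p0)/call_shift.
  by have -> : I (l1 * z) + (D - L) + L = I (l1 * z) + D by lra.
case: ifPn => [t2|_].
  by rewrite z2 mulr1; apply: active; exact: lt_le_trans t2.
have [tz|zt'|/eqP] := ltgtP (t / l1) z; last by rewrite eq_sym (negbTE zt).
- rewrite z2 mulr0 add0r mulr1 -[X in strict_argmax _ _ X]add0r.
  apply/call_shift/call_strict_argmax_default => //.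
  by move: tz; rewrite ltr_pdivrMr// mulrC.
- by rewrite mulr1 mulr0 addr0; exact: active.
Qed.

Lemma X_low_default l1 xi2 w : xi2 <= xi w ->
  X_ESP_low P M U D L l1 xi2 w = 0.
Proof.
move=> z2; rewrite /X_ESP_low; case: ifPn => [_|].
  by rewrite [(xi w < xi2)%R]ltNge z2 mulr0.
rewrite -ltNge => /lt_le_trans-/(_ (xi w)%:E); rewrite lee_fin => /(_ z2) h.
by rewrite [(xi w < xi2)%R]ltNge z2 andbF ltNge (ltW h) !mulr0 addr0.
Qed.

End low.

Section mid.
Hypothesis (DL : D < L).

Lemma mid_attained p : 0 < p ->
  exists2 x, L <= x & forall y, L <= y -> u y - p * y <= u x - p * x.
Proof.
move=> p0; have [pL|Lp] := leP p (dU (L - D)).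
  have H := call_strict_argmax_inside hU _ _ _ DL p0 pL.
  by exists (I p + D); [case: H|exact: (strict_argmax_le H)].
have H := call_strict_argmax_boundary hU _ _ _ DL (ltW Lp).
by exists L => //; exact: (strict_argmax_le H).
Qed.

Lemma X_mid_argmax l1 xi2 w : 0 < l1 -> 0 < xi w -> xi w < xi2 ->
  strict_argmax L (fun y => u y - l1 * xi w * y) (X_ESP_mid P M U D L l1 xi2 w).
Proof.
move=> l10 z0 z2; rewrite /X_ESP_mid.
set z := xi w in z0 z2 *; have p0 : 0 < l1 * z by rewrite mulr_gt0.
set t := dU _.
have active : z < t / l1 ->
    strict_argmax L (fun y => u y - l1 * z * y) (I (l1 * z) + D).
  rewrite ltr_pdivlMr// mulrC => /ltW; exact: call_strict_argmax_inside.
case: ifPn => [t2|_].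
  by rewrite z2 mulr1; apply: active; exact: lt_trans t2.
have [zt|tz] := ltP z (t / l1); last first.
  rewrite z2 mulr0 add0r mulr1; apply: call_strict_argmax_boundary => //.
  by move: tz; rewrite ler_pdivrMr// mulrC.
by rewrite mulr1 mulr0 addr0; exact: active.
Qed.

Lemma X_mid_default l1 xi2 w : xi2 <= xi w ->
  X_ESP_mid P M U D L l1 xi2 w = 0.
Proof.
move=> z2; rewrite /X_ESP_mid; case: ifPn => [_|].
  by rewrite ltNge z2 mulr0.
rewrite -leNgt => /le_trans-/(_ (xi w))/(_ z2) h.
by rewrite [(xi w < xi2)%R]ltNge z2 andbF ltNge h !mulr0 addr0.
Qed.

End mid.

(** With q = p - l2 the objective is at most u y - q y - l2 L, with equality for
    y <= L, and at most u y - p y, with equality for y >= L. So the maximizer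
    for slope [p] is optimal when it exceeds [L], the one for slope [q] when it
    is below [L], and in between the kink at [L] is: there U' (L - D) is a
    supergradient slope, and it separates [q] from [p]. *)
Lemma X_high_argmax l1 l2 w : tangent_point U D < L -> 0 < l1 -> 0 <= l2 ->
  0 < xi w -> xi w != (dU (tangent_point U D - D) + l2) / l1 ->
  strict_argmax 0 (fun y => u y - l1 * xi w * y - l2 * Num.max (L - y) 0)
    (X_ESP_high P M U D L l1 l2 w).
Proof.
move=> tL l10 l20 z0; rewrite /X_ESP_high.
set z := xi w in z0 *.
have [Dt _] := tangent_pointP hU _ D0.
set t := tangent_point U D in tL Dt *.
have tD0 : 0 < t - D by lra.
have DL : D < L by lra.
have LD0 : 0 < L - D by lra.
have ct : dU (L - D) < dU (t - D) by apply: marginal_lt => //; lra.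
have c0 : 0 < dU (L - D) by exact: marginal_gt0.
set c := dU (L - D) in ct c0 *; set c' := dU (t - D) in ct *.
move=> z3.
have p0 : 0 < l1 * z by rewrite mulr_gt0.
have cmp x : (z < x / l1) = (l1 * z < x) by rewrite ltr_pdivlMr// mulrC.
have cmp' x : (x / l1 <= z) = (x <= l1 * z) by rewrite ler_pdivrMr// mulrC.
have {}z3 : l1 * z != c' + l2.
  by apply: contraNN z3 => /eqP <-; rewrite mulrC mulKf// gt_eqF.
rewrite !cmp !cmp'.
set p := l1 * z in p0 z3 *.
have relax y : u y - p * y - l2 * Num.max (L - y) 0
    <= u y - (p - l2) * y - l2 * L.
  have : l2 * (L - y) <= l2 * Num.max (L - y) 0.
    by rewrite ler_wpM2l// le_max lexx.
  lra.
have relaxE x : x <= L ->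
    u x - p * x - l2 * Num.max (L - x) 0 = u x - (p - l2) * x - l2 * L.
  by move=> xL; rewrite [Num.max (L - x) _]max_l ?subr_ge0//; lra.
have via_relax x : x <= L ->
    strict_argmax 0 (fun y => u y - (p - l2) * y) x ->
    strict_argmax 0 (fun y => u y - p * y - l2 * Num.max (L - y) 0) x.
  move=> xL [x0 H]; split=> // y y0 yx; rewrite [ltRHS]relaxE//.
  apply: (le_lt_trans (relax y)); have /= := H _ y0 yx; lra.
have [pc|cp] := ltP p c.
  rewrite mulr1 [p < c + l2]ltr_wpDr//= mulr0 addr0.
  have -> : (c + l2 <= p) = false by apply/negbTE; rewrite -ltNge ltr_wpDr.
  rewrite mulr0 addr0.
  have [x0 H] := call_strict_argmax_active hU _ _ D0 p0 (lt_trans pc ct).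
  have xL : L < I p + D.
    by rewrite -ltrBlDr (lt_inv_marginal hU).
  split=> // y y0 yx.
  rewrite [Num.max (L - (_ + _)) _]max_r; last by rewrite subr_le0 ltW.
  rewrite mulr0 subr0; apply: le_lt_trans (H _ y0 yx).
  by rewrite gerBl mulr_ge0// le_max lexx orbT.
rewrite mulr0 add0r.
have [pc2|cp2] := ltP p (c + l2).
  rewrite mulr1 mulr0 addr0.
  (* For cost slope [c] the maximizer is [L] itself. *)
  have HL := call_strict_argmax_active hU _ _ D0 c0 ct.
  have {HL}[_ H] : strict_argmax 0 (fun y => u y - c * y) L.
    by have -> : L = I c + D by rewrite /c (marginalK hU)// subrK.
  split=> [|y y0 yL]; first exact: ltW.
  rewrite subrr [Num.max 0 0]max_r// mulr0 subr0.
  have := H _ y0 yL.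
  have [Ly|yL'] := leP L y.
    rewrite [Num.max (L - y) _]max_r ?subr_le0//.
    have : (c - p) * (y - L) <= 0 by apply: mulr_le0_ge0; lra.
    lra.
  rewrite [Num.max (L - y) _]max_l; last by rewrite subr_ge0 ltW.
  have : 0 <= (c - (p - l2)) * (L - y) by apply: mulr_ge0; lra.
  lra.
rewrite mulr0 add0r.
have [pc3|cp3|/eqP] := ltgtP p (c' + l2); last by rewrite (negbTE z3).
  have q0 : 0 < p - l2 by lra.
  have qc' : p - l2 < c' by lra.
  rewrite mulr1; apply: via_relax; last exact: call_strict_argmax_active.
  rewrite -lerBrDr leNgt (lt_inv_marginal hU)// -leNgt -/c; lra.
rewrite mulr0; apply: via_relax; first exact: ltW.
by apply: call_strict_argmax_default => //; rewrite -/c'; lra.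
Qed.

End regimes.

(** * Expectations and quantiles *)

Section probability_facts.
Context {R : realType} {d : measure_display} {Omega : measurableType d}.
Context {P : probability Omega R}.

Lemma expectation_integral (f : Omega -> R) :
  ('E_P[f] = \int[P]_w (f w)%:E)%E.
Proof. by rewrite unlock. Qed.

Lemma ae_eq0_of_integral_le0 (f : Omega -> R) :
  P.-integrable setT (EFin \o f) -> {ae P, forall w, 0 <= f w} ->
  ('E_P[f] <= 0)%E -> {ae P, forall w, f w = 0}.
Proof.
rewrite expectation_integral => fi f0 intf.
have mf := measurable_int _ fi.
have absE : (\int[P]_w `|(f w)%:E| = \int[P]_w (f w)%:E)%E.
  apply: ae_eq_integral => //.
    apply/(measurable_EFinP _ (Num.norm \o f))/measurableT_comp => //.
    exact/measurable_EFinP.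
  by apply: filterS f0 => w w0 _ /=; rewrite ger0_norm.
have : (\int[P]_w `|(f w)%:E| = 0)%E.
  by apply/eqP; rewrite eq_le integral_ge0// andbT absE.
move/(ae_eq_integral_abs P measurableT mf).
by apply: filterS => w /(_ I) [].
Qed.

Lemma ae_eq_expectation (f g : Omega -> R) : measurable_fun setT f ->
  measurable_fun setT g -> {ae P, forall w, f w = g w} -> ('E_P[f] = 'E_P[g])%E.
Proof.
move=> mf mg fg; rewrite !expectation_integral; apply: ae_eq_integral => //.
- exact/measurable_EFinP.
- exact/measurable_EFinP.
- by apply: filterS fg => w /= ->.
Qed.

Lemma integrable_of_expectation_lty (f : Omega -> R) : measurable_fun setT f ->
  {ae P, forall w, 0 <= f w} -> ('E_P[f] < +oo)%E ->
  P.-integrable setT (EFin \o f).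
Proof.
move=> mf f0 intf; apply/integrableP; split; first exact/measurable_EFinP.
rewrite expectation_integral in intf; apply: le_lt_trans intf.
rewrite le_eqVlt; apply/orP; left; apply/eqP/ae_eq_integral => //.
- by apply/(measurable_EFinP _ (Num.norm \o f))/measurableT_comp.
- exact/measurable_EFinP.
- by apply: filterS f0 => w w0 _ /=; rewrite ger0_norm.
Qed.

Lemma integrable_bounded (f : Omega -> R) (c : R) : measurable_fun setT f ->
  (forall w, `|f w| <= c) -> P.-integrable setT (EFin \o f).
Proof.
move=> mf fc.
have ic := finite_measure_integrable_cst P c (@measurableT _ Omega).
apply: (le_integrable _ _ _ ic) => //.
  exact/measurable_EFinP.
move=> w _ /=; rewrite lee_fin; apply: le_trans (fc w) _; exact: ler_norm.
Qed.

Lemma measurable_indicator (b : Omega -> bool) : measurable_fun setT b ->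
  measurable_fun setT (fun w => (b w)%:R : R).
Proof.
move=> mb.
rewrite (_ : (fun w => _) = (fun w => if b w then 1 else 0)); last first.
  by apply/funext => w; case: (b w).
exact: measurable_fun_ifT.
Qed.

Lemma expectationE (f : Omega -> R) : P.-integrable setT (EFin \o f) ->
  'E_P[f]%E = (fine 'E_P[f])%:E.
Proof.
by move=> fi; rewrite fineK// expectation_integral; exact: integrable_fin_num.
Qed.

End probability_facts.

(** The upper tail is the distribution function of [- f], hence continuous from
    one side; without atoms it is also the complementary distribution function
    of [f], hence continuous from the other, and takes all values in ]0, 1[. *)
Lemma atomless_upper_quantile {R : realType} {d : measure_display}
  {Omega : measurableType d} (P : probability Omega R)
  (f : Omega -> R) (a : R) :
  measurable_fun setT f -> (forall c, P [set w | f w = c] = 0%E) -> 0 < a < 1 ->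
  exists c, P [set w | c <= f w] = a%:E.
Proof.
move=> mf atomless /andP[a0 a1].
have mfc c : measurable [set w | f w = c].
  by rewrite -[X in measurable X]setTI; exact: (mf measurableT [set c]).
have mfr (B : set R) : measurable B -> measurable (f @^-1` B).
  by move=> mB; rewrite -[X in measurable X]setTI; exact: mf.
pose X : {RV P >-> R} := HB.pack f (isMeasurableFun.Build _ _ _ _ f mf).
have mg : measurable_fun setT (fun w => - f w) by exact: measurableT_comp.
pose Y : {RV P >-> R} := HB.pack (fun w => - f w)
  (isMeasurableFun.Build _ _ _ _ (fun w => - f w) mg).
have YE r : cdf Y r = P [set w | - r <= f w].
  rewrite /cdf /distribution /pushforward; congr (P _).
  by apply/seteqP; split => w /=; rewrite in_itv/= lerNl.
have XE r : cdf Y r = ccdf X (- r).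
  rewrite YE /ccdf /distribution /pushforward.
  have -> : [set w | - r <= f w] = [set w | f w = - r] `|` X @^-1` `]- r, +oo[.
    apply/seteqP; split => w /=; rewrite in_itv/= andbT le_eqVlt.
      by case/predU1P => [->|->]; [left|right].
    by case=> [->|->]; rewrite ?eqxx ?orbT.
  by rewrite setUC; apply: measureU0; [exact: mfr|exact: mfc|exact: atomless].
pose G r := fine (cdf Y r).
have Gfin r : cdf Y r = (G r)%:E by rewrite fineK// fin_num_measure.
have Gcont : continuous G.
  move=> r; apply/left_right_continuousP; split.
    apply/cvg_at_leftNP; apply: fine_cvg; rewrite -Gfin XE.
    rewrite (_ : (fun x => cdf Y (- x)) = ccdf X); last first.
      by apply/funext => s; rewrite XE opprK.
    exact: ccdf_right_continuous.
  by apply: fine_cvg; rewrite -Gfin; exact: cdf_right_continuous.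
have [r1 Gr1] : exists r, G r < a.
  have /fine_cvg/cvgr_lt/(_ a a0) : cdf Y @ -oo%R --> (0 : R)%:E.
    exact: cvg_cdfNy0.
  by move=> /(@filter_ex _ _ _ _)[r Hr]; exists r.
have [r2 Gr2] : exists r, a < G r.
  have /fine_cvg/cvgr_gt/(_ a a1) : cdf Y @ +oo%R --> (1 : R)%:E.
    exact: cvg_cdfy1.
  by move=> /(@filter_ex _ _ _ _)[r Hr]; exists r.
have r12 : r1 <= r2.
  have [//|r21] := leP r1 r2.
  have := cdf_nondecreasing Y (ltW r21).
  by rewrite !Gfin lee_fin leNgt (lt_trans Gr1 Gr2).
have [||c _ Gc] := @IVT R G r1 r2 a r12.
- by apply: continuous_subspaceT => x; exact: Gcont.
- by rewrite ge_min le_max (ltW Gr1) (ltW Gr2) orbT.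
- by exists (- c); rewrite -YE Gfin Gc.
Qed.

(** * The state price density *)

Section market_facts.
Context {R : realType} {d : measure_display} {Omega : measurableType d}.
Context {P : probability Omega R} {m : nat}.
Context {M : market (R := R) (Omega := Omega) m}.
Hypothesis hM : complete_market P M.

Local Notation xi := (state_price P M).

Lemma terminal_measurableP (X : Omega -> R) :
  measurable_wrt (info M (horizon M)) X <-> measurable_fun setT X.
Proof.
rewrite /measurable_wrt (filtration_end (info_filtration hM)).
split=> [H _ B mB|H B mB]; first by rewrite setTI; exact: H.
by rewrite -[X in measurable X]setTI; exact: H.
Qed.

Lemma nonneg_claimP (X : Omega -> R) :
  nonneg_claim M X <-> measurable_fun setT X /\ forall w, 0 <= X w.
Proof. by rewrite /nonneg_claim terminal_measurableP. Qed.

Lemma bond_measurable t : 0 <= t <= horizon M -> measurable_fun setT (bond M t).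
Proof.
move=> tT; apply/terminal_measurableP => B mB.
have /andP[t0 t1] := tT.
apply: (filtration_mono (info_filtration hM) t0 t1 (lexx _)).
exact: (bond_adapted hM).
Qed.

Lemma pricing_dominated : charge_of_finite_measure (pricing M) `<< P.
Proof. by have [] := pricing_lmm hM. Qed.

Lemma Radon_Nikodym_measurable : measurable_fun setT
  (fun w => fine (Radon_Nikodym (charge_of_finite_measure (pricing M)) P w)).
Proof.
apply: measurableT_comp => //.
exact: measurable_int (Radon_Nikodym_integrable pricing_dominated).
Qed.

Lemma state_price_measurable : measurable_fun setT xi.
Proof.
have T0 := ltW (horizon_gt0 hM).
apply: measurable_funM; last exact: Radon_Nikodym_measurable.
apply: measurable_funM; first by apply: bond_measurable; rewrite lexx T0.
(* On positive numbers the inverse is [expR (- ln x)], which is measurable. *)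
rewrite (_ : (fun w => _) =
  (fun w => expR (- ln (bond M (horizon M) w)))).
  apply: measurableT_comp => //; apply: measurableT_comp => //.
  apply: measurableT_comp; first exact: measurable_ln.
  by apply: bond_measurable; rewrite lexx T0.
apply/funext => w; rewrite expRN lnK// posrE.
by apply: (bond_gt0 hM); rewrite lexx T0.
Qed.

(** The pricing measure gives no mass to the event where its density is not
    positive, and it dominates [P]. *)
Lemma state_price_gt0 : {ae P, forall w, 0 < xi w}.
Proof.
set f := Radon_Nikodym (charge_of_finite_measure (pricing M)) P.
pose N := [set w | (f w <= 0)%E].
have mf : measurable_fun setT f.
  exact: measurable_int (Radon_Nikodym_integrable pricing_dominated).
have mN : measurable N.
  by rewrite -[N]setTI; exact: emeasurable_fun_infty_c.
have N0 : P N = 0%E.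
  have [_ PQ _] := pricing_lmm hM.
  apply: (null_content_dominatesP P (pricing M)).1 => //=.
  have QN : pricing M N = (\int[P]_(w in N) f w)%E.
    exact: Radon_Nikodym_integral pricing_dominated mN.
  apply/eqP; rewrite eq_le measure_ge0// andbT QN.
  rewrite -[leRHS](integral0 P N).
  apply: le_integral => //.
  - apply: integrableS (Radon_Nikodym_integrable pricing_dominated) => //.
  - exact: integrable0.
  - by move=> w; rewrite inE.
exists N; split => // w /= w0.
apply: contrapT => Nw; apply: w0.
have T0 := ltW (horizon_gt0 hM).
rewrite /state_price; apply: mulr_gt0.
  by apply: divr_gt0; apply: (bond_gt0 hM); rewrite ?lexx ?T0.
rewrite -lte_fin fineK; last exact: Radon_Nikodym_fin_num pricing_dominated.
by rewrite ltNge; exact/negP.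
Qed.

End market_facts.

(** * Measurability and sign of the candidate wealths *)

Section candidates.
Context {R : realType} {d : measure_display} {Omega : measurableType d}.
Context {P : probability Omega R} {m : nat}.
Context {M : market (R := R) (Omega := Omega) m}.
Context {U : R -> R} {D L : R}.
Hypotheses (hM : complete_market P M) (hU : utility U)
  (D0 : 0 < D) (L0 : 0 < L).
Local Notation xi := (state_price P M).
Local Notation I := (inv_marginal U).

(** Not monotone on the real line, because of the value 0 on nonpositive
    numbers; the superlevel sets are still intervals. *)
Lemma measurable_inv_marginal : measurable_fun setT I.
Proof.
apply: (measurability _ (RGenCInfty.measurableE R)) => _ [_ [r ->] <-].
rewrite setTI; have [r0|r0] := leP r 0.
  rewrite (_ : _ @^-1` _ = setT)//; apply/seteqP; split => // y _ /=.
  by rewrite in_itv/= andbT (le_trans r0)// inv_marginal_ge0.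
rewrite (_ : _ @^-1` _ = [set` `]0, derive1 U r]])//.
apply/seteqP; split => y /=; rewrite !in_itv/= andbT.
  have [y0|y0] := leP y 0; first by rewrite inv_marginal_le0// leNgt r0.
  rewrite leNgt => /negP Iy; rewrite leNgt; apply/negP => ry; apply: Iy.
  rewrite ltNge; apply/negP => Iy.
  have := marginal_le hU _ _ r0 Iy.
  by rewrite (inv_marginalK hU)// leNgt ry.
move=> /andP[y0 yr]; rewrite leNgt; apply/negP => Iy.
have := marginal_lt hU _ _ (inv_marginal_gt0 hU _ y0) Iy.
by rewrite (inv_marginalK hU)// ltNge yr.
Qed.

Let mI (l1 c : R) : measurable_fun setT (fun w => I (l1 * xi w - c) + D).
Proof.
apply: measurable_funD => //; apply: measurableT_comp.
  exact: measurable_inv_marginal.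
apply: measurable_funB => //; apply: measurable_funM => //.
exact: state_price_measurable.
Qed.

Let mI0 (l1 : R) : measurable_fun setT (fun w => I (l1 * xi w) + D).
Proof.
rewrite (_ : (fun w => _) = (fun w => I (l1 * xi w - 0) + D)); first exact: mI.
by apply/funext => w; rewrite subr0.
Qed.

Let mlt (c : R) : measurable_fun setT (fun w => (xi w < c)%R).
Proof. by apply: measurable_fun_ltr => //; exact: state_price_measurable. Qed.

Let mle (c : R) : measurable_fun setT (fun w => (c <= xi w)%R).
Proof. by apply: measurable_fun_ler => //; exact: state_price_measurable. Qed.

Let I_ge0 (y : R) : 0 <= I y + D.
Proof. by rewrite addr_ge0 ?inv_marginal_ge0// ltW. Qed.

Lemma X_B_measurable lB : measurable_fun setT (X_B P M U D lB).
Proof. by apply: measurable_funM => //; exact: measurable_indicator. Qed.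

Lemma X_B_ge0 lB w : 0 <= X_B P M U D lB w.
Proof. by rewrite /X_B mulr_ge0. Qed.

Lemma X_ESP_low_measurable l1 xi2 :
  measurable_fun setT (X_ESP_low P M U D L l1 xi2).
Proof.
rewrite /X_ESP_low; case: (xi2%:E <= ESP_low_xi1 U D L l1)%E.
  by apply: measurable_funM => //; exact: measurable_indicator.
have mx : measurable_fun setT (EFin \o xi).
  exact/measurable_EFinP/state_price_measurable.
apply: measurable_funD; apply: measurable_funM => //.
  by apply: measurable_indicator; exact: measurable_fun_lte.
by apply: measurable_indicator; apply: measurable_and => //;
  exact: measurable_fun_lee.
Qed.

Lemma X_ESP_low_ge0 l1 xi2 w : 0 <= X_ESP_low P M U D L l1 xi2 w.
Proof.
by rewrite /X_ESP_low; case: ifP => _; rewrite ?addr_ge0// mulr_ge0// ltW.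
Qed.

Lemma X_ESP_mid_measurable l1 xi2 :
  measurable_fun setT (X_ESP_mid P M U D L l1 xi2).
Proof.
rewrite /X_ESP_mid; case: (xi2 < derive1 U (L - D) / l1).
  by apply: measurable_funM => //; exact: measurable_indicator.
apply: measurable_funD; apply: measurable_funM => //.
  exact: measurable_indicator.
by apply: measurable_indicator; exact: measurable_and.
Qed.

Lemma X_ESP_mid_ge0 l1 xi2 w : 0 <= X_ESP_mid P M U D L l1 xi2 w.
Proof.
by rewrite /X_ESP_mid; case: ifP => _; rewrite ?addr_ge0// mulr_ge0// ltW.
Qed.

Lemma X_ESP_high_measurable l1 l2 :
  measurable_fun setT (X_ESP_high P M U D L l1 l2).
Proof.
rewrite /X_ESP_high; apply: measurable_funD.
  apply: measurable_funD; apply: measurable_funM => //.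
    exact: measurable_indicator.
  by apply: measurable_indicator; exact: measurable_and.
apply: measurable_funM => //.
by apply: measurable_indicator; exact: measurable_and.
Qed.

Lemma X_ESP_high_ge0 l1 l2 w : 0 <= X_ESP_high P M U D L l1 l2 w.
Proof. by rewrite /X_ESP_high !addr_ge0// mulr_ge0// ltW. Qed.

(** The problem without the risk constraint is the case of a zero risk
    multiplier. *)
Lemma X_B_argmax lB w : 0 < lB -> 0 < xi w ->
  xi w != derive1 U (tangent_point U D - D) / lB ->
  strict_argmax 0 (fun y => U (Num.max (y - D) 0) - lB * xi w * y
     - 0 * Num.max (L - y) 0) (X_B P M U D lB w).
Proof.
move=> lB0 z0 zt; rewrite /X_B.
have p0 : 0 < lB * xi w by rewrite mulr_gt0.
suff [x_ge0 H] : strict_argmax 0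
    (fun y => U (Num.max (y - D) 0) - lB * xi w * y)
    ((I (lB * xi w) + D) *
      (xi w < derive1 U (tangent_point U D - D) / lB)%R%:R).
  by split=> // y y0 yx; rewrite !mul0r !subr0; exact: H.
have [zlt|zgt|ztE] := ltgtP (xi w) (derive1 U (tangent_point U D - D) / lB).
- rewrite mulr1; apply: call_strict_argmax_active => //.
  by rewrite mulrC -ltr_pdivlMr.
- rewrite mulr0; apply: call_strict_argmax_default => //.
  by rewrite mulrC -ltr_pdivrMr.
- by rewrite ztE eqxx in zt.
Qed.

Hypothesis hatomless : forall c : R, P [set w | xi w = c] = 0%E.

Lemma ae_neq (c : R) : {ae P, forall w, xi w != c}.
Proof.
exists [set w | xi w = c]; split => //.
  rewrite -[X in measurable X]setTI.
  exact: (state_price_measurable hM measurableT [set c]).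
by move=> w /= /negP; rewrite negbK => /eqP.
Qed.

End candidates.

(** * The Lagrangian of a claim *)

Section claims.
Context {R : realType} {d : measure_display} {Omega : measurableType d}.
Context {P : probability Omega R} {m : nat}.
Context {M : market (R := R) (Omega := Omega) m}.
Context {U : R -> R} {x0 D L eps : R}.
Hypotheses (hM : complete_market P M)
  (hatomless : forall c : R, P [set w | state_price P M w = c] = 0%E)
  (hD : 0 < D) (hL : 0 < L) (hU : utility U).
Implicit Types (X Y Z : Omega -> R).

Local Notation xi := (state_price P M).
Local Notation util X := (fun w => U (Num.max (X w - D) 0)).
Local Notation loss X := (fun w => Num.max (L - X w) 0).
Local Notation gain l1 l2 X :=
  (fun w => U (Num.max (X w - D) 0) - l1 * xi w * X w
     - l2 * Num.max (L - X w) 0).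
Local Notation integrable_real f := (P.-integrable setT (EFin \o f)).
Local Notation gain_argmax l1 l2 w x :=
  (strict_argmax 0 (fun y => U (Num.max (y - D) 0) - l1 * xi w * y
     - l2 * Num.max (L - y) 0) x).

Lemma measurable_utility_payoff X : measurable_fun setT X ->
  measurable_fun setT (util X).
Proof.
move=> mX.
have -> : util X = (fun y => U (Num.max y 0)) \o (fun w => X w - D) by [].
apply: measurableT_comp; last exact: measurable_funB.
apply: nondecreasing_measurable => // y z yz.
apply: (utility_le hU); first by rewrite le_max lexx orbT.
by rewrite ge_max !le_max yz lexx orbT.
Qed.

Lemma measurable_loss X : measurable_fun setT X -> measurable_fun setT (loss X).
Proof. by move=> mX; apply: measurable_maxr => //; exact: measurable_funB. Qed.

Lemma measurable_cost X : measurable_fun setT X ->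
  measurable_fun setT (fun w => xi w * X w).
Proof.
by move=> mX; apply: measurable_funM => //; exact: state_price_measurable.
Qed.

Lemma util_ge0 X w : 0 <= U (Num.max (X w - D) 0).
Proof. by apply: utility_ge0 => //; rewrite le_max lexx orbT. Qed.

Lemma loss_ge0 X w : 0 <= Num.max (L - X w) 0.
Proof. by rewrite le_max lexx orbT. Qed.

Lemma integrable_loss X : measurable_fun setT X -> (forall w, 0 <= X w) ->
  integrable_real (loss X).
Proof.
move=> mX X_ge0; apply: (integrable_bounded _ L); first exact: measurable_loss.
move=> w; rewrite ger0_norm ?loss_ge0// ge_max (ltW hL) andbT.
by rewrite gerBl.
Qed.

Lemma integrable_cost X : measurable_fun setT X -> (forall w, 0 <= X w) ->
  (price P M X < +oo)%E -> integrable_real (fun w => xi w * X w).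
Proof.
move=> mX X_ge0; apply: integrable_of_expectation_lty.
  exact: measurable_cost.
by apply: filterS (state_price_gt0 hM) => w w0; rewrite mulr_ge0// ltW.
Qed.

Lemma integrable_util X : measurable_fun setT X ->
  (expected_utility P U D X < +oo)%E -> integrable_real (util X).
Proof.
move=> mX; apply: integrable_of_expectation_lty.
  exact: measurable_utility_payoff.
by apply: aeW => w; exact: util_ge0.
Qed.

Lemma integrable_gain l1 l2 X : integrable_real (util X) ->
  integrable_real (fun w => xi w * X w) -> integrable_real (loss X) ->
  integrable_real (gain l1 l2 X).
Proof.
move=> iu ic il.
apply: (@eq_integrable _ _ _ P _ measurableT
  ((EFin \o util X) \- (fun w => l1%:E * (EFin \o (fun w => xi w * X w)%R) w)
    \- (fun w => l2%:E * (EFin \o loss X) w))%E).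
  by move=> w _ /=; rewrite mulrA.
by apply: integrableB => //; [apply: integrableB => //|]; exact: integrableZl.
Qed.

Lemma lagrangianE l1 l2 X : integrable_real (util X) ->
  integrable_real (fun w => xi w * X w) -> integrable_real (loss X) ->
  lagrangian P M U x0 D L eps l1 l2 X
  = ('E_P[gain l1 l2 X] + (l1 * x0 + l2 * eps)%:E)%E.
Proof.
move=> iu ic il; rewrite /lagrangian /expected_utility /price /shortfall.
rewrite (expectationE _ iu) (expectationE _ ic) (expectationE _ il).
have -> : ('E_P[gain l1 l2 X] =
    'E_P[util X] - l1%:E * 'E_P[(fun w => xi w * X w)%R]
    - l2%:E * 'E_P[loss X])%E.
  rewrite !expectation_integral.
  pose c w := (l1%:E * (EFin \o (fun w => xi w * X w)%R) w)%E.
  pose l w := (l2%:E * (EFin \o loss X) w)%E.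
  have ic' : P.-integrable setT c by exact: integrableZl.
  have il' : P.-integrable setT l by exact: integrableZl.
  transitivity (\int[P]_w (((EFin \o util X) \- c) \- l) w)%E.
    by apply: eq_integral => w _ /=; rewrite /c /l /= -(mulrA l1) !EFinB.
  have iuc := integrableB measurableT iu ic'.
  rewrite [LHS](integralB measurableT iuc il').
  rewrite [X in (X - _)%E](integralB measurableT iu ic').
  by rewrite !integralZl.
rewrite (expectationE _ iu) (expectationE _ ic) (expectationE _ il).
rewrite -?EFinB -?EFinM -?EFinB -?EFinD; congr (_%:E); ring.
Qed.

Section pointwise.
Context {X : Omega -> R} {l1 l2 : R}.
Hypotheses (mX : measurable_fun setT X) (X_ge0 : forall w, 0 <= X w)
  (pX : (price P M X < +oo)%E) (uX : (expected_utility P U D X < +oo)%E)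
  (maxX : forall Y, nonneg_claim M Y -> (price P M Y < +oo)%E ->
    (lagrangian P M U x0 D L eps l1 l2 Y <=
     lagrangian P M U x0 D L eps l1 l2 X)%E).

(** Suppose [Z] does better than [X] on an event. Replacing [X] by [Z] on the
    part of it where [Z] and the state price are at most [n] keeps price and
    utility finite and raises the Lagrangian unless that part is null; let [n]
    grow. *)
Lemma pointwise_max Z : measurable_fun setT Z -> (forall w, 0 <= Z w) ->
  {ae P, forall w, gain l1 l2 Z w <= gain l1 l2 X w}.
Proof.
move=> mZ Z_ge0.
have mxi := state_price_measurable hM.
have mgain Y : measurable_fun setT Y -> measurable_fun setT (gain l1 l2 Y).
  move=> mY; apply: measurable_funB.
    apply: measurable_funB; first exact: measurable_utility_payoff.
    by apply: measurable_funM => //; exact: measurable_funM.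
  by apply: measurable_funM => //; exact: measurable_loss.
have iuX := integrable_util X mX uX.
have icX := integrable_cost X mX X_ge0 pX.
have ilX := integrable_loss X mX X_ge0.
pose b n w :=
  [&& gain l1 l2 X w < gain l1 l2 Z w, Z w <= n%:R & `|xi w| <= n%:R].
have nb n : {ae P, forall w, ~ b n w}.
  have mb : measurable_fun setT (b n).
    apply: measurable_and.
      by apply: measurable_fun_ltr; exact: mgain.
    apply: measurable_and; apply: measurable_fun_ler => //.
    exact: measurableT_comp.
  pose Y w := if b n w then Z w else X w.
  have mY : measurable_fun setT Y by exact: measurable_fun_ifT.
  have Y_ge0 w : 0 <= Y w by rewrite /Y; case: ifP.
  have icY : integrable_real (fun w => xi w * Y w).
    have ib := finite_measure_integrable_cst P (n%:R * n%:R : R)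
      (@measurableT _ Omega).
    apply: (le_integrable measurableT _ _
      (integrableD measurableT (integrable_norm icX) ib)) => //.
      exact/measurable_EFinP/measurable_cost.
    move=> w _ /=; rewrite lee_fin [leRHS]ger0_norm ?addr_ge0// /Y.
    case: ifP => [/and3P[_ Zn xn]|_]; last by rewrite lerDl.
    rewrite normrM (ger0_norm (Z_ge0 w)); apply: ler_wpDl => //.
    exact: ler_pM.
  have iuY : integrable_real (util Y).
    have Un : 0 <= U n%:R by apply: utility_ge0.
    have ib := finite_measure_integrable_cst P (U n%:R) (@measurableT _ Omega).
    apply: (le_integrable measurableT _ _
      (integrableD measurableT iuX ib)) => //.
      exact/measurable_EFinP/measurable_utility_payoff.
    move=> w _ /=; rewrite lee_fin !ger0_norm ?addr_ge0 ?util_ge0// /Y.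
    case: ifP => [/and3P[_ Zn xn]|_]; last by rewrite lerDl.
    apply: ler_wpDl; first exact: util_ge0.
    apply: utility_le => //; first by rewrite le_max lexx orbT.
    rewrite ge_max ler0n andbT; apply: le_trans Zn.
    by rewrite gerBl ltW.
  have ilY := integrable_loss Y mY Y_ge0.
  have igX := integrable_gain l1 l2 X iuX icX ilX.
  have igY := integrable_gain l1 l2 Y iuY icY ilY.
  have : {ae P, forall w, gain l1 l2 Y w - gain l1 l2 X w = 0}.
    apply: ae_eq0_of_integral_le0.
    - have -> : EFin \o (fun w => gain l1 l2 Y w - gain l1 l2 X w) =
        ((EFin \o gain l1 l2 Y) \- (EFin \o gain l1 l2 X))%E by [].
      exact: integrableB.
    - apply: aeW => w; rewrite subr_ge0 /Y; case: ifP => // /and3P[/ltW].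
      by [].
    - rewrite expectation_integral.
      rewrite (_ : (fun w => _) =
        ((EFin \o gain l1 l2 Y) \- (EFin \o gain l1 l2 X))%E)//.
      rewrite integralB// sube_le0.
      have pY : (price P M Y < +oo)%E.
        by rewrite /price expectation_integral; exact: integrable_lty.
      have := maxX Y ((nonneg_claimP hM Y).2 (conj mY Y_ge0)) pY.
      rewrite !lagrangianE// leeD2rE//.
      by rewrite !expectation_integral.
  apply: filterS => w; rewrite /Y => /eqP + bw.
  rewrite bw subr_eq0 => /eqP E.
  by move: bw; rewrite /b E ltxx.
apply: filterS (ae_foralln nb) => w H; rewrite leNgt; apply/negP => XZ.
pose n := (Num.truncn (Num.max (Z w) `|xi w|)).+1.
apply: (H n); rewrite /b XZ /=.
by rewrite -ge_max ltW// truncnS_gt.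
Qed.

End pointwise.

(** The alternative [c = 0] covers the case of equal multipliers, where nothing
    is known about the difference of the expectations. *)
Lemma scaled_difference (c : R) (f g : Omega -> R) :
  c = 0 \/ [/\ integrable_real f, integrable_real g & ('E_P[f] = 'E_P[g])%E] ->
  integrable_real (fun w => c * (f w - g w)) /\
  (\int[P]_w (c * (f w - g w))%:E = 0)%E.
Proof.
case=> [->|[fi gi fg]].
  have -> : (fun w => 0 * (f w - g w)) = cst 0.
    by apply/funext => w; rewrite mul0r.
  split; first exact: (finite_measure_integrable_cst P 0 measurableT).
  by under eq_integral do rewrite mul0r; rewrite integral0.
have fgi : P.-integrable setT ((EFin \o f) \- (EFin \o g))%E.
  exact: integrableB.
split; first exact: (integrableZl measurableT c fgi).
transitivity (c%:E * \int[P]_w ((EFin \o f) \- (EFin \o g)) w)%E.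
  by rewrite -integralZl.
rewrite (integralB measurableT fi gi) -!expectation_integral.
rewrite fg subee ?mule0// (expectationE _ gi)//.
Qed.

(** Let Du, Dp, Ds be the differences of utility, cost and loss between [X] and
    [X0]. Pointwise maximality gives [l1 Dp + l2 Ds <= Du <= k1 Dp + k2 Ds], and
    the gap [(k1 - l1) Dp + (k2 - l2) Ds] has expectation 0. So it vanishes,
    [X0] attains the maximum for (l1, l2), and strictness gives [X0 = X]. *)
Lemma saddle_unique {X0 X} {k1 k2 l1 l2} :
  measurable_fun setT X0 -> (forall w, 0 <= X0 w) -> (price P M X0 < +oo)%E ->
  (forall Z, measurable_fun setT Z -> (forall w, 0 <= Z w) ->
    {ae P, forall w, gain k1 k2 Z w <= gain k1 k2 X0 w}) ->
  measurable_fun setT X -> (forall w, 0 <= X w) ->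
  {ae P, forall w, gain_argmax l1 l2 w (X w)} ->
  l1 = k1 \/ price P M X = price P M X0 ->
  l2 = k2 \/ shortfall P L X = shortfall P L X0 ->
  {ae P, forall w, X0 w = X w}.
Proof.
move=> mX0 X0_ge0 pX0 max0 mX X_ge0 maxX eq1 eq2.
have [i1 E1] :
    integrable_real (fun w => (k1 - l1) * (xi w * X w - xi w * X0 w)) /\
    (\int[P]_w ((k1 - l1) * (xi w * X w - xi w * X0 w))%:E = 0)%E.
  apply: (@scaled_difference (k1 - l1) (fun w => xi w * X w)
    (fun w => xi w * X0 w)).
  case: eq1 => [->|pE]; [by left; rewrite subrr|right; split => //].
    by apply: integrable_cost => //; rewrite pE.
  exact: integrable_cost.
have [i2 E2] :
    integrable_real (fun w => (k2 - l2) * (loss X w - loss X0 w)) /\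
    (\int[P]_w ((k2 - l2) * (loss X w - loss X0 w))%:E = 0)%E.
  apply: (@scaled_difference (k2 - l2) (loss X) (loss X0)).
  by case: eq2 => [->|pE]; [left; rewrite subrr|right; split => //;
    exact: integrable_loss].
pose h w := (k1 - l1) * (xi w * X w - xi w * X0 w)
  + (k2 - l2) * (loss X w - loss X0 w).
have h0 : {ae P, forall w, h w = 0}.
  apply: ae_eq0_of_integral_le0.
  - exact: (integrableD measurableT i1 i2).
  - have := max0 X mX X_ge0; apply: filterS2 maxX => w Xw H.
    have := strict_argmax_le Xw _ (X0_ge0 w); rewrite /h; move: H => /=; lra.
  - rewrite expectation_integral /h.
    rewrite [leLHS](integralD measurableT i1 i2).
    by rewrite [X in (X + _)%E]E1 E2 adde0.
have := max0 X mX X_ge0; apply: filterS3 maxX h0 => w [Xw0 Xw] hw H.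
apply/eqP; apply: contraTT isT => X0X.
have := Xw _ (X0_ge0 w) X0X; move: hw H; rewrite /h /=; lra.
Qed.

(** At a zero price of wealth, adding a constant amount above [D] would improve
    every claim. *)
Lemma budget_multiplier_gt0 {X0} {k1 k2} : 0 <= k1 -> 0 <= k2 ->
  measurable_fun setT X0 -> (forall w, 0 <= X0 w) ->
  (forall Z, measurable_fun setT Z -> (forall w, 0 <= Z w) ->
    {ae P, forall w, gain k1 k2 Z w <= gain k1 k2 X0 w}) ->
  0 < k1.
Proof.
rewrite le_eqVlt => /predU1P[<- k20 mX0 X0_ge0 max0|//].
pose Z w := X0 w + (D + 1).
have mZ : measurable_fun setT Z by exact: measurable_funD.
have Z_ge0 w : 0 <= Z w by rewrite /Z !addr_ge0// ltW.
have [|w] := filter_ex (max0 Z mZ Z_ge0).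
  apply: ae_properfilter_algebraOfSetsType.
  by have : (0 < P setT)%E by rewrite probability_setT lte01.
have [X0w D_gt0] := (X0_ge0 w, hD).
have : U (Num.max (X0 w - D) 0) < U (Num.max (Z w - D) 0).
  apply: (utility_incr hU); first by rewrite le_max lexx orbT.
  by rewrite /Z gt_max !lt_max; apply/andP; split; apply/orP; left; lra.
have : k2 * Num.max (L - Z w) 0 <= k2 * Num.max (L - X0 w) 0.
  rewrite ler_wpM2l// ge_max !le_max lexx orbT andbT.
  by apply/orP; left; rewrite /Z; lra.
lra.
Qed.

(** * Optimal claims *)

Hypothesis heps : 0 < eps.
Context {Xopt : Omega -> R} {k1 k2 : R}.
Hypotheses (hopt : optimal P M U x0 D L eps Xopt)
  (hfin : (expected_utility P U D Xopt < +oo)%E)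
  (hmult : lagrange_multipliers P M U x0 D L eps Xopt k1 k2)
  (hnr : non_redundant P M U x0 D L eps).

Lemma optimal_facts Y : optimal P M U x0 D L eps Y ->
  [/\ measurable_fun setT Y, forall w, 0 <= Y w, price P M Y = x0%:E,
      (shortfall P L Y <= eps%:E)%E &
      expected_utility P U D Y = expected_utility P U D Xopt].
Proof.
move=> [fY maxY]; have [[/(nonneg_claimP hM)[mY Y_ge0] _ pY] sY _] := fY.
have [fX maxX] := hopt.
by split=> //; apply/eqP; rewrite eq_le maxX//= maxY.
Qed.

(** Optimal claims share utility and price, so complementary slackness for one
    of them forces it for all. *)
Lemma optimal_multipliers Y : optimal P M U x0 D L eps Y ->
  lagrange_multipliers P M U x0 D L eps Y k1 k2.
Proof.
move=> optY; have [mY Y_ge0 pY sY uY] := optimal_facts _ optY.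
have [mX X_ge0 pX sX _] := optimal_facts _ hopt.
have [k1_ge0 k2_ge0 maxX _ slack] := hmult.
have cY : nonneg_claim M Y by apply/(nonneg_claimP hM).
have ilX := integrable_loss _ mX X_ge0.
have ilY := integrable_loss _ mY Y_ge0.
have iuX := integrable_util _ mX hfin.
have YX := maxX Y cY; rewrite pY in YX; move/(_ (ltry _)) in YX.
move: (YX) slack; rewrite /lagrangian uY pX pY subee// mule0 sube0.
move: sX sY; rewrite /expected_utility (expectationE _ iuX).
rewrite /shortfall (expectationE _ ilX) (expectationE _ ilY).
set s := fine _; set t := fine _; set u := fine _.
rewrite !lee_fin => sX sY.
move=> le_st [] slack.
have slackY : k2 * (t - eps) = 0.
  have h : k2 * (t - eps) <= 0.
    by rewrite -[leRHS](mulr0 k2) ler_wpM2l// subr_le0.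
  by apply/eqP; rewrite eq_le h/=; lra.
split=> //.
- move=> Z cZ pZ; apply: (le_trans (maxX Z cZ pZ)).
  rewrite /lagrangian uY pX pY subee// mule0 sube0.
  rewrite /expected_utility (expectationE _ iuX).
  rewrite /shortfall (expectationE _ ilX) (expectationE _ ilY) -/u -/s -/t.
  by rewrite lee_fin slack slackY.
- by rewrite pY subee// mule0.
- by rewrite /shortfall (expectationE _ ilY) -/t; congr (_%:E).
Qed.

Lemma optimal_pointwise Y Z : optimal P M U x0 D L eps Y ->
  measurable_fun setT Z -> (forall w, 0 <= Z w) ->
  {ae P, forall w, gain k1 k2 Z w <= gain k1 k2 Y w}.
Proof.
move=> optY; have [mY Y_ge0 pY sY uY] := optimal_facts _ optY.
have [_ _ maxY _ _] := optimal_multipliers _ optY.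
by apply: (pointwise_max mY Y_ge0 _ _ maxY); rewrite ?pY ?ltry// uY.
Qed.

Lemma budget_multiplier : 0 < k1.
Proof.
have [mX X_ge0 _ _ _] := optimal_facts _ hopt.
have [k1_ge0 k2_ge0 _ _ _] := hmult.
apply: (budget_multiplier_gt0 k1_ge0 k2_ge0 mX X_ge0).
by move=> Z; exact: optimal_pointwise.
Qed.

Lemma ae_price_not (c : R) : {ae P, forall w, 0 < xi w /\ xi w != c}.
Proof.
apply: filterS2 (state_price_gt0 hM) (ae_neq hM hatomless c) => w; by split.
Qed.

Lemma optimal_unique {X l1 l2} Y : optimal P M U x0 D L eps Y ->
  measurable_fun setT X -> (forall w, 0 <= X w) ->
  {ae P, forall w, gain_argmax l1 l2 w (X w)} ->
  l1 = k1 \/ price P M X = x0%:E ->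
  l2 = k2 \/ shortfall P L X = shortfall P L Y ->
  {ae P, forall w, Y w = X w}.
Proof.
move=> optY mX X_ge0 maxX e1 e2.
have [mY Y_ge0 pY _ _] := optimal_facts _ optY.
have pY_fin : (price P M Y < +oo)%E by rewrite pY ltry.
rewrite -pY in e1.
apply: (saddle_unique mY Y_ge0 pY_fin _ mX X_ge0 maxX e1 e2).
by move=> Z; exact: optimal_pointwise.
Qed.

(** With a zero risk multiplier the optimum would be the claim [X_B], which
    violates the risk constraint. *)
Lemma risk_multiplier : k2 != 0.
Proof.
apply/eqP => k20.
have [lB [lB0 pB sB]] := hnr.
have mB := X_B_measurable (D := D) hM hU lB.
have B_ge0 := X_B_ge0 (P := P) (M := M) (U := U) hU hD lB.
have [mX X_ge0 pX sX _] := optimal_facts _ hopt.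
have maxB : {ae P, forall w, gain_argmax lB 0 w (X_B P M U D lB w)}.
  set c := derive1 U (tangent_point U D - D) / lB.
  apply: filterS (ae_price_not c) => w [z0 zt].
  exact: X_B_argmax.
have XB := optimal_unique _ hopt mB B_ge0 maxB (or_intror pB)
  (or_introl (esym k20)).
move: sB; rewrite ltNge => /negP; apply; apply: le_trans sX.
rewrite le_eqVlt; apply/orP; left; apply/eqP/ae_eq_expectation.
- exact: measurable_loss.
- exact: measurable_loss.
- by apply: filterS XB => w ->.
Qed.

Lemma optimal_shortfall Y : optimal P M U x0 D L eps Y ->
  shortfall P L Y = eps%:E.
Proof.
move=> optY; have [mY Y_ge0 _ _ _] := optimal_facts _ optY.
have [_ _ _ _] := optimal_multipliers _ optY.
rewrite /shortfall (expectationE _ (integrable_loss _ mY Y_ge0)).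
rewrite -EFinB -EFinM => -[] /eqP; rewrite mulf_eq0 (negbTE risk_multiplier)/=.
by rewrite subr_eq0 => /eqP ->.
Qed.

Lemma price_congr X Y : measurable_fun setT X -> measurable_fun setT Y ->
  {ae P, forall w, Y w = X w} -> price P M X = price P M Y.
Proof.
move=> mX mY YX; apply: ae_eq_expectation; [exact: measurable_cost..|].
by apply: filterS YX => w ->.
Qed.

Lemma shortfall_congr X Y : measurable_fun setT X -> measurable_fun setT Y ->
  {ae P, forall w, Y w = X w} -> shortfall P L X = shortfall P L Y.
Proof.
move=> mX mY YX; apply: ae_eq_expectation; [exact: measurable_loss..|].
by apply: filterS YX => w ->.
Qed.

(** A candidate that shares the budget multiplier of the optimum need not be
    known to satisfy the budget equation: it does, being the optimum. *)
Lemma candidate_price {X l2} :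
  measurable_fun setT X -> (forall w, 0 <= X w) ->
  {ae P, forall w, gain_argmax k1 l2 w (X w)} ->
  l2 = k2 \/ shortfall P L X = eps%:E ->
  price P M X = x0%:E /\ shortfall P L X = eps%:E.
Proof.
move=> mX X_ge0 maxX e2.
have [mX0 X0_ge0 pX _ _] := optimal_facts _ hopt.
have sX := optimal_shortfall _ hopt.
rewrite -sX in e2 *.
have E := optimal_unique _ hopt mX X_ge0 maxX (or_introl erefl) e2.
by rewrite (price_congr _ _ mX mX0 E) (shortfall_congr _ _ mX mX0 E).
Qed.

Lemma candidate_the_optimal {X l1 l2} :
  measurable_fun setT X -> (forall w, 0 <= X w) ->
  {ae P, forall w, gain_argmax l1 l2 w (X w)} ->
  price P M X = x0%:E -> shortfall P L X = eps%:E ->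
  the_optimal P M U x0 D L eps X.
Proof.
move=> mX X_ge0 maxX pX sX.
have uniq Y : optimal P M U x0 D L eps Y -> {ae P, forall w, Y w = X w}.
  move=> optY; apply: (optimal_unique _ optY mX X_ge0 maxX); first by right.
  by right; rewrite (optimal_shortfall _ optY).
split=> //.
have cX : nonneg_claim M X by apply/(nonneg_claimP hM).
split.
  split; rewrite ?pX ?sX//; split=> //.
  by have [? ?] := cX; apply: (completeness hM) => //; rewrite pX ltry.
have [mX0 _ _ _ _] := optimal_facts _ hopt.
suff -> : expected_utility P U D X = expected_utility P U D Xopt by case: hopt.
apply: ae_eq_expectation; [exact: measurable_utility_payoff..|].
by apply: filterS (uniq _ hopt) => w ->.
Qed.

Lemma eps_lt_L : eps < L.
Proof.
have [lB [lB0 pB sB]] := hnr.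
rewrite -lte_fin; apply: lt_le_trans sB _.
have mB := X_B_measurable (D := D) hM hU lB.
have B_ge0 := X_B_ge0 (P := P) (M := M) (U := U) hU hD lB.
have ib := integrable_loss _ mB B_ge0.
rewrite -[leRHS]mule1 -(probability_setT P) -integral_cst//.
rewrite /shortfall expectation_integral; apply: le_integral => //.
  exact: (finite_measure_integrable_cst P L measurableT).
by move=> w _; rewrite lee_fin ge_max gerBl (B_ge0 _) ltW.
Qed.

(** The threshold is an upper quantile of the state price, at level [eps / L]. *)
Lemma threshold_exists : exists xi2, threshold_eq P M L eps xi2.
Proof.
have a01 : 0 < eps / L < 1.
  by rewrite divr_gt0//= ltr_pdivrMr// mul1r eps_lt_L.
have [c Pc] := atomless_upper_quantile P _ _ (state_price_measurable hM)
  hatomless a01.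
exists c; rewrite /threshold_eq.
have mc : measurable [set w | c <= xi w].
  rewrite -[X in measurable X]setTI.
  rewrite (_ : [set w | _] = xi @^-1` `[c, +oo[).
    exact: (state_price_measurable hM).
  by apply/seteqP; split => w /=; rewrite in_itv/= andbT.
transitivity (L%:E * \int[P]_w (\1_[set w | c <= xi w] w)%:E)%E.
  rewrite -integralZl//; last exact: integrable_indic.
  rewrite expectation_integral; apply: eq_integral => w _ /=.
  rewrite -EFinM indicE; congr (L * (nat_of_bool _)%:R)%:E.
  by apply/idP/idP; rewrite ?inE// => /set_mem.
rewrite integral_indic// setIT; move: Pc => /= ->.
by rewrite -EFinM mulrC divfK// gt_eqF.
Qed.

Lemma threshold_gt0 xi2 : threshold_eq P M L eps xi2 -> 0 < xi2.
Proof.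
move=> t2; rewrite ltNge; apply/negP => xi2_le0.
have := eps_lt_L; suff -> : eps = L by rewrite ltxx.
apply: EFin_inj; rewrite -t2.
rewrite (@ae_eq_expectation _ _ _ _ _ (cst L))//.
- by rewrite expectation_cst.
- apply: measurable_funM => //; apply: measurable_indicator.
  by apply: measurable_fun_ler => //; exact: state_price_measurable.
- apply: filterS (state_price_gt0 hM) => w w0.
  by rewrite (le_trans xi2_le0 (ltW w0)) mulr1.
Qed.

(** Cases (i) and (ii) together: [F l1] is the best claim above [L] when the
    state price is below the threshold and 0 otherwise, so its shortfall is
    [eps] whatever [l1]. *)
Section threshold_candidate.
Context {F : R -> Omega -> R} {xi2 : R}.
Hypotheses (t2 : threshold_eq P M L eps xi2)
  (mF : forall l1, measurable_fun setT (F l1))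
  (F_ge0 : forall l1 w, 0 <= F l1 w)
  (Fmax : forall l1, 0 < l1 -> {ae P, forall w, xi w < xi2 ->
    strict_argmax L (fun y => U (Num.max (y - D) 0) - l1 * xi w * y) (F l1 w)})
  (F0 : forall l1 w, xi2 <= xi w -> F l1 w = 0)
  (star : forall y, 0 <= y -> y <= L ->
     U (Num.max (y - D) 0) * L <= U (Num.max (L - D) 0) * y)
  (attained : forall p, 0 < p -> exists2 x, L <= x & forall y, L <= y ->
     U (Num.max (y - D) 0) - p * y <= U (Num.max (x - D) 0) - p * x).

Lemma threshold_shortfall l1 : 0 < l1 -> shortfall P L (F l1) = eps%:E.
Proof.
move=> l10; rewrite -t2; apply: ae_eq_expectation.
- exact: measurable_loss.
- apply: measurable_funM => //; apply: measurable_indicator.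
  by apply: measurable_fun_ler => //; exact: state_price_measurable.
apply: filterS (Fmax l1 l10) => w Fw.
have [z2|/Fw[LF _]] := leP xi2 (xi w).
  by rewrite F0// subr0 mulr1 max_l// ltW.
by rewrite mulr0 max_r// subr_le0.
Qed.

Lemma threshold_gain_argmax l1 : 0 < l1 ->
  exists l2, {ae P, forall w, gain_argmax l1 l2 w (F l1 w)}.
Proof.
move=> l10; have t0 := threshold_gt0 _ t2.
have u0 : U (Num.max (0 - D) 0) = 0.
  by rewrite max_r ?(utility0 hU)// sub0r oppr_le0 ltW.
have [l2 H] := @threshold_strict_argmax _ (fun y => U (Num.max (y - D) 0)) L
  hL u0 star attained l1 xi2 l10 t0.
exists l2; apply: filterS2 (Fmax l1 l10) (ae_price_not xi2) => w Fw [z0 zt].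
by apply: H => // /ltW /F0.
Qed.

Lemma threshold_candidate :
  [/\ 0 < k1, price P M (F k1) = x0%:E &
      forall l1, 0 < l1 -> price P M (F l1) = x0%:E ->
        the_optimal P M U x0 D L eps (F l1)].
Proof.
split; first exact: budget_multiplier.
  have [l2 maxF] := threshold_gain_argmax _ budget_multiplier.
  have sF := threshold_shortfall _ budget_multiplier.
  by have [] := candidate_price (mF k1) (F_ge0 k1) maxF (or_intror sF).
move=> l1 l10 pF; have [l2 maxF] := threshold_gain_argmax _ l10.
exact: (candidate_the_optimal (mF l1) (F_ge0 l1) maxF pF
  (threshold_shortfall _ l10)).
Qed.

End threshold_candidate.

End claims.

Theorem proposition4 (R : realType) (d : measure_display)
  (Omega : measurableType d) (P : probability Omega R) (m : nat)
  (M : market (R := R) (Omega := Omega) m)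
  (U : R -> R) (x0 D L eps : R)
  (hM : complete_market P M)
  (hatomless : forall c : R, P [set w | state_price P M w = c] = 0%E)
  (hx0 : 0 < x0) (hD : 0 < D) (hL : 0 < L) (heps : 0 < eps)
  (hU : utility U)
  (Xopt : Omega -> R) (hopt : optimal P M U x0 D L eps Xopt)
  (hfin : (expected_utility P U D Xopt < +oo)%E)
  (lambda1 lambda2 : R)
  (hmult : lagrange_multipliers P M U x0 D L eps Xopt lambda1 lambda2)
  (hnr : non_redundant P M U x0 D L eps) :
  [/\ (* (i) *)
      L <= D ->
        (exists xi2 : R, threshold_eq P M L eps xi2) /\
        forall xi2 : R, threshold_eq P M L eps xi2 ->
          [/\ 0 < lambda1,
              price P M (X_ESP_low P M U D L lambda1 xi2) = x0%:E &
              forall l1 : R, 0 < l1 ->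
                price P M (X_ESP_low P M U D L l1 xi2) = x0%:E ->
                the_optimal P M U x0 D L eps (X_ESP_low P M U D L l1 xi2)],
      (* (ii) *)
      D < L <= tangent_point U D ->
        (exists xi2 : R, threshold_eq P M L eps xi2) /\
        forall xi2 : R, threshold_eq P M L eps xi2 ->
          [/\ 0 < lambda1,
              price P M (X_ESP_mid P M U D L lambda1 xi2) = x0%:E &
              forall l1 : R, 0 < l1 ->
                price P M (X_ESP_mid P M U D L l1 xi2) = x0%:E ->
                the_optimal P M U x0 D L eps (X_ESP_mid P M U D L l1 xi2)] &
      (* (iii) *)
      tangent_point U D < L ->
        [/\ 0 < lambda1,
            price P M (X_ESP_high P M U D L lambda1 lambda2) = x0%:E,
            shortfall P L (X_ESP_high P M U D L lambda1 lambda2) = eps%:E &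
            forall l1 l2 : R, 0 < l1 -> 0 <= l2 ->
              price P M (X_ESP_high P M U D L l1 l2) = x0%:E ->
              shortfall P L (X_ESP_high P M U D L l1 l2) = eps%:E ->
              the_optimal P M U x0 D L eps (X_ESP_high P M U D L l1 l2)]].
Proof.
have xi1P := ae_price_not hM hatomless.
split.
- move=> LD; split.
    exact: (threshold_exists hM hatomless hD hL hU heps hnr).
  move=> xi2 t2.
  apply: (threshold_candidate (F := fun l1 => X_ESP_low P M U D L l1 xi2)
    hM hatomless hD hL hU hopt hfin hmult hnr t2) => [l1|l1 w|l1 l10|l1 w||].
  + exact: X_ESP_low_measurable.
  + exact: X_ESP_low_ge0.
  + (* For an infinite threshold, [fine] excludes the null state price 0. *)
    apply: filterS (xi1P (fine (ESP_low_xi1 U D L l1))) => w [z0 zt] z2.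
    apply: X_low_argmax => //; apply: contraNN zt => /eqP E.
    by rewrite -E.
  + exact: X_low_default.
  + exact: low_star.
  + exact: low_attained.
- move=> /andP[DL Lt]; split.
    exact: (threshold_exists hM hatomless hD hL hU heps hnr).
  move=> xi2 t2.
  apply: (threshold_candidate (F := fun l1 => X_ESP_mid P M U D L l1 xi2)
    hM hatomless hD hL hU hopt hfin hmult hnr t2) => [l1|l1 w|l1 l10|l1 w||].
  + exact: X_ESP_mid_measurable.
  + exact: X_ESP_mid_ge0.
  + apply: filterS (state_price_gt0 hM) => w z0 z2.
    exact: X_mid_argmax.
  + exact: X_mid_default.
  + exact: call_star.
  + exact: mid_attained.
- move=> tL.
  have mF l1 l2 := X_ESP_high_measurable (D := D) (L := L) hM hU l1 l2.
  have F_ge0 l1 l2 := X_ESP_high_ge0 (P := P) (M := M) hU hD hL l1 l2.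
  have maxF l1 l2 : 0 < l1 -> 0 <= l2 -> {ae P, forall w,
      strict_argmax 0 (fun y => U (Num.max (y - D) 0)
        - l1 * state_price P M w * y - l2 * Num.max (L - y) 0)
      (X_ESP_high P M U D L l1 l2 w)}.
    move=> l10 l20.
    set xi3 := (derive1 U (tangent_point U D - D) + l2) / l1.
    apply: filterS (xi1P xi3) => w [z0 zt].
    exact: X_high_argmax.
  have l1_gt0 := budget_multiplier hM hD hL hU hopt hfin hmult.
  have l2_ge0 := multiplier_risk_ge0 hmult.
  have [pF sF] := candidate_price hM hatomless hD hL hU hopt hfin hmult hnr
    (mF _ _) (F_ge0 _ _) (maxF _ _ l1_gt0 l2_ge0) (or_introl erefl).
  split=> // l1 l2 l10 l20 pX sX.
  exact: (candidate_the_optimal hM hatomless hD hL hU hopt hfin hmult hnr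
    (mF _ _) (F_ge0 _ _) (maxF _ _ l10 l20) pX sX).
Qed.
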